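(* Let $n\ge 1$ and let $A=(a_1\le\dots\le a_n)$ and $B=(b_1\le\dots\le b_n)$ be $n$-tuples of integers, all $\ge 2$, which are of the same type. Then the Schubert varieties $\mathrm{sh}_A$ and $\mathrm{sh}_B$ are isomorphic: $\mathrm{sh}_A\simeq \mathrm{sh}_B$.
   Context: Everything is over $\mathbb{C}$. Fusion product: for positive integers $A=(a_1,\dots,a_n)$ choose pairwise distinct $z_1,\dots,z_n\in\mathbb{C}$ and let $\mathbb{C}^{a_i}(z_i)$ be the evaluation module of $\mathfrak{sl}_2\otimes\mathbb{C}[t]$, i.e. the irreducible $a_i$-dimensional $\mathfrak{sl}_2$-module on which $x_k:=x\otimes t^k$ acts as $z_i^k x$. The tensor product $V=\bigotimes_i\mathbb{C}^{a_i}(z_i)$ is cyclic, generated by the tensor product $v$ of lowest weight vectors. Filter $V$ by the subspaces $V^{(m)}$ spanned by $x^{(1)}_{k_1}\cdots x^{(r)}_{k_r}v$ with $x^{(l)}\in\mathfrak{sl}_2$ and $k_1+\dots+k_r\le m$. The fusion product $M^A$ is the associated graded $\mathfrak{sl}_2\otimes\mathbb{C}[t]$-module; it is (known to be) independent of the $z_i$, and $\mathfrak{sl}_2\otimes t^n\mathbb{C}[t]$ acts by zero, so it is an $\mathfrak{sl}_2\otimes(\mathbb{C}[t]/t^n)$-module. Let $v_A\in M^A$ be the image of $v$ (the lowest weight vector with respect to $h_0$). Schubert variety: $G=\mathrm{SL}_2(\mathbb{C}[t]/t^n)$ acts on $M^A$ and on $\mathbb{P}(M^A)$; put $[v_A]=\mathbb{C}v_A\in\mathbb{P}(M^A)$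 and, for $2\le a_1\le\dots\le a_n$, $\mathrm{sh}_A=\overline{G\cdot[v_A]}\subset\mathbb{P}(M^A)$, a projective variety. Type: $A$ is of the type $\{i_1,\dots,i_s\}$ (an ordered tuple of positive integers with $i_1+\dots+i_s=n$) if $a_1=\dots=a_{i_1}\ne a_{i_1+1}=\dots=a_{i_1+i_2}\ne\dots\ne a_{n-i_s+1}=\dots=a_n$. *)

(* Defs.v *)
From HB Require Import structures.
From mathcomp Require Import all_boot all_order all_algebra.
From mathcomp Require Import qpoly.
From mathcomp Require Import boolp.
From mathcomp Require Import mpoly.
From mathcomp Require Import ring.

Set Implicit Arguments.
Unset Strict Implicit.
Unset Printing Implicit Defensive.

Import GRing.Theory.
Local Open Scope ring_scope.

Section Span.
Variables (F : fieldType) (V : vectType F).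
Implicit Types (U : {vspace V}) (P : V -> Prop).

Lemma ex_vspan P : exists U,
  (forall v, P v -> v \in U) /\
  (forall U', (forall v, P v -> v \in U') -> (U <= U')%VS).
Proof.
pose Q (d : nat) := `[< exists U, \dim U = d /\ forall v, P v -> v \in U >].
have exQ : exists d, Q d.
  exists (\dim {:V}); apply/asboolP; exists fullv; split=> // v _.
  exact: memvf.
case: (ex_minnP exQ) => d /asboolP[U [dU PU]] minU.
exists U; split=> // U' PU'; apply/capv_idPl/eqP.
rewrite eqEdim capvSl dU; apply: minU; apply/asboolP.
by exists (U :&: U')%VS; split=> // v Pv; rewrite memv_cap PU ?PU'.
Qed.

Definition vspan P : {vspace V} := sval (cid (ex_vspan P)).

Lemma mem_vspan P v : P v -> v \in vspan P.
Proof. by rewrite /vspan; case: cid => U /= [PU _] /PU. Qed.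

Lemma vspan_sub P U : (forall v, P v -> v \in U) -> (vspan P <= U)%VS.
Proof. by rewrite /vspan; case: cid => U0 /= [_ minU] /minU. Qed.

Lemma vspan_mono_stable (P : nat -> V -> Prop) :
    (forall i j v, (i <= j)%N -> P i v -> P j v) ->
  exists N, `[< forall m, (N <= m)%N -> vspan (P m) = vspan (P N) >].
Proof.
move=> monoP.
have sub i j : (i <= j)%N -> (vspan (P i) <= vspan (P j))%VS.
  by move=> ij; apply: vspan_sub => v /(monoP _ _ _ ij); apply: mem_vspan.
pose Q d := `[< exists N, \dim (vspan (P N)) = d >].
have exQ : exists d, Q d.
  by exists (\dim (vspan (P 0%N))); apply/asboolP; exists 0%N.
have leQ d : Q d -> (d <= \dim {:V})%N.
  by move=> /asboolP[N <-]; rewrite dimvS ?subvf.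
case: (ex_maxnP exQ leQ) => d /asboolP[N dN] maxd.
exists N; apply/asboolP=> m Nm; apply/eqP; rewrite eq_sym eqEdim sub //= dN.
by apply: maxd; apply/asboolP; exists m.
Qed.

End Span.

(** The irreducible [a]-dimensional module of [sl_2], realized as
    [Sym^(a-1)] of the natural module with basis [w_j = X^j Y^(a-1-j)],
    [0 <= j < a]: [e = delta_mx 0 1] acts as [X d/dY], [f = delta_mx 1 0] as
    [Y d/dX] and [h] as [X d/dX - Y d/dY], so that [w_0] is the lowest weight
    vector. Matrices act on column vectors: column [j] is the image of [w_j]. *)
Definition sl2_rep (F : fieldType) (a : nat) (x : 'M[F]_2) : 'M[F]_a :=
  \matrix_(l < a, j < a)
    (x 0 1 * (a.-1 - j)%:R * (l == j.+1 :> nat)%:R +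
     (x 0 0 * j%:R + x 1 1 * (a.-1 - j)%:R) * (l == j :> nat)%:R +
     x 1 0 * j%:R * (l.+1 == j :> nat)%:R).

Section Fusion.
Variables (F : fieldType) (n : nat) (a : 'I_n -> nat) (z : 'I_n -> F).

(** The tensor product of the [F^(a i)], [i < n]: coordinates with respect to
    the tensor products of the [w_j], which are indexed by multi-indices. *)
Definition multi_index := {dffun forall i : 'I_n, 'I_(a i)}.
Definition tensor : vectType F := {ffun multi_index -> F^o}.

Definition subst_index (s : multi_index) (i : 'I_n) (j : 'I_(a i)) :
  multi_index := [ffun k : 'I_n => dfwith s j k].

Definition factor_act (i : 'I_n) (x : 'M[F]_2) (u : tensor) : tensor :=
  [ffun s : multi_index =>
     \sum_(j < a i) sl2_rep (a i) x (s i) j * u (subst_index s j)].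

(** [x_k = x (x) t^k] acting on the tensor product of the evaluation modules. *)
Definition eval_act (x : 'M[F]_2) (k : nat) (u : tensor) : tensor :=
  \sum_(i < n) z i ^+ k *: factor_act i x u.

Definition lowest_vector : tensor :=
  [ffun s : multi_index => [forall i, s i == 0 :> nat]%:R].

Definition fusion_monomial (m : nat) (u : tensor) : Prop :=
  exists s : seq ('M[F]_2 * nat),
    [/\ all (fun xk => \tr xk.1 == 0) s,
        (sumn [seq xk.2 | xk <- s] <= m)%N &
        u = foldr (fun xk w => eval_act xk.1 xk.2 w) lowest_vector s].

Definition fusion_filt (m : nat) : {vspace tensor} := vspan (fusion_monomial m).

Definition fusion_filt_pred (m : nat) : {vspace tensor} :=
  if m is m'.+1 then fusion_filt m' else 0%VS.

Lemma fusion_filt_stable : exists N,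
  `[< forall m, (N <= m)%N -> fusion_filt m = fusion_filt N >].
Proof.
apply: vspan_mono_stable => i j u ij [s [trs les ->]].
by exists s; split=> //; apply: leq_trans les ij.
Qed.

Definition fusion_len : nat := ex_minn fusion_filt_stable.

(** The quotient [V^(m) / V^(m-1)] is realized as the complement
    [V^(m) :\: V^(m-1)]; the quotient map is the projection onto it along
    [V^(m-1)]. *)
Definition gr_piece (m : nat) : {vspace tensor} :=
  (fusion_filt m :\: fusion_filt_pred m)%VS.

Definition gr_class (m : nat) : tensor -> tensor :=
  addv_pi1 (fusion_filt m) (fusion_filt_pred m).

(** The (external) direct sum of the [V^(m) / V^(m-1)]; those with
    [m > fusion_len] vanish. *)
Definition gr_space : {vspace {ffun 'I_fusion_len.+1 -> tensor}} :=
  vspan (fun f : {ffun 'I_fusion_len.+1 -> tensor} =>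
    forall m, f m \in gr_piece m).

Definition fusion : vectType F := subvs_of gr_space.

Definition fusion_act (x : 'M[F]_2) (k : nat) (u : fusion) : fusion :=
  vsproj gr_space
    [ffun m : 'I_fusion_len.+1 =>
       \sum_(j : 'I_fusion_len.+1 | (j + k == m)%N)
          gr_class m (eval_act x k (vsval u j))].

Definition fusion_vector : fusion :=
  vsproj gr_space
    [ffun m : 'I_fusion_len.+1 =>
       if m == 0 :> nat then gr_class 0 lowest_vector else 0].

End Fusion.

Section Projective.
Variable F : fieldType.
Implicit Types M N : vectType F.

(** The points of [P(M)] are the lines of [M]. *)
Definition proj M := {L : {vspace M} | \dim L == 1%N}.

(** Values of polynomials in the coordinates given by the basis
    [vbasis {:M}]. *)
Definition poly_eval M (p : {mpoly F[\dim {:M}]}) (u : M) : F :=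
  p.@[fun i => coord (vbasis {:M}) i u].

Definition vanishes M (p : {mpoly F[\dim {:M}]}) (L : proj M) : Prop :=
  forall u, u \in val L -> poly_eval p u = 0.

Definition zariski_closure M (S : proj M -> Prop) (L : proj M) : Prop :=
  forall d (p : {mpoly F[\dim {:M}]}), p \is d.-homog ->
    (forall L', S L' -> vanishes p L') -> vanishes p L.

(** A map between subsets of projective spaces is regular when, around each
    point [L], it is given by homogeneous polynomials [p i] of the same degree
    that do not all vanish; the open set here is the set of all points of [X]
    at which the [p i] do not all vanish, which is no restriction (multiply
    the [p i] by an equation cutting out the complement of a smaller one). *)
Definition regular_on M N (X : proj M -> Prop) (phi : proj M -> proj N) :=
  forall L, X L -> exists d (p : 'I_(\dim {:N}) -> {mpoly F[\dim {:M}]}),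
    [/\ forall i, p i \is d.-homog,
        exists i, ~ vanishes (p i) L &
        forall L', X L' -> (exists i, ~ vanishes (p i) L') ->
          forall u, u \in val L' ->
            \sum_i poly_eval (p i) u *: (vbasis {:N})`_i \in val (phi L')].

Definition proj_isomorphic M N (X : proj M -> Prop) (Y : proj N -> Prop) :=
  exists (phi : proj M -> proj N) (psi : proj N -> proj M),
    [/\ (forall L, X L -> Y (phi L)) /\ (forall L, Y L -> X (psi L)),
        forall L, X L -> psi (phi L) = L,
        forall L, Y L -> phi (psi L) = L,
        regular_on X phi & regular_on Y psi].

End Projective.

Section Elementary.
Variable R : comUnitRingType.
Implicit Types (g h : 'M[R]_2) (p q : R).

Lemma det_mx22 h : \det h = h 0 0 * h 1 1 - h 0 1 * h 1 0.
Proof.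
rewrite (expand_det_row _ 0) !big_ord_recl big_ord0 /cofactor !det_mx11 !mxE.
rewrite /= addr0 expr0 expr1 mul1r mulN1r mulrN.
by congr (h _ _ * h _ _ - h _ _ * h _ _); apply/val_inj.
Qed.

Lemma mulmx22E g h i j : (g *m h) i j = g i 0 * h 0 j + g i 1 * h 1 j.
Proof.
rewrite mxE !big_ord_recl big_ord0 addr0.
by congr (_ + g _ _ * h _ _); apply/val_inj.
Qed.

Lemma matrix22P g h : g 0 0 = h 0 0 -> g 0 1 = h 0 1 -> g 1 0 = h 1 0 ->
  g 1 1 = h 1 1 -> g = h.
Proof.
move=> g00 g01 g10 g11; apply/matrixP => i j.
have ord2 (k : 'I_2) : k = 0 \/ k = 1.
  by case: k => [[|[|]]] // ?; [left | right]; apply: val_inj.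
by case: (ord2 i) (ord2 j) => -> [] ->.
Qed.

Lemma SL2_elementary g : \det g = 1 -> g 1 0 \is a GRing.unit ->
  g = (1%:M + ((g 0 0 - 1) / g 1 0) *: delta_mx 0 1) *m
      (1%:M + g 1 0 *: delta_mx 1 0) *m
      (1%:M + ((g 1 1 - 1) / g 1 0) *: delta_mx 0 1).
Proof.
rewrite det_mx22; set c := g 1 0 => det1 Uc.
set p := (_ / _); set q := (_ / _).
have pc : p * c = g 0 0 - 1 by rewrite divrK.
have qc : q * c = g 1 1 - 1 by rewrite divrK.
have g01 : g 0 1 = p + q + p * c * q.
  apply: (mulIr Uc).
  have -> : (p + q + p * c * q) * c = p * c + q * c + p * c * (q * c) by ring.
  rewrite pc qc; have -> : g 0 1 * c = g 0 0 * g 1 1 - 1 by rewrite -det1 subKr.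
  ring.
apply: matrix22P; rewrite !mulmx22E !mxE /= ?mulr0n ?mulr1n.
- rewrite -[g 0 0](subrK 1) -pc; ring.
- rewrite g01; ring.
- rewrite -/c; ring.
- rewrite -[g 1 1](subrK 1) -qc; ring.
Qed.

Lemma SL2_shift g :
  g = (1%:M + (- 1) *: delta_mx 1 0) *m ((1%:M + 1 *: delta_mx 1 0) *m g).
Proof. apply: matrix22P; rewrite !mulmx22E !mxE /= ?mulr0n ?mulr1n; ring. Qed.

Lemma SL2_shift10 g : ((1%:M + 1 *: delta_mx 1 0) *m g) 1 0 = g 0 0 + g 1 0.
Proof. rewrite !mulmx22E !mxE /= ?mulr0n ?mulr1n; ring. Qed.

Lemma SL2_shift_det g : \det ((1%:M + 1 *: delta_mx 1 0) *m g) = \det g.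
Proof. rewrite det_mulmx !det_mx22 !mxE /= ?mulr0n ?mulr1n; ring. Qed.
End Elementary.

Section GroupAction.
Variables (F : fieldType) (n : nat) (M : vectType F).
(** [act x k] is the action of [x (x) t^k] on [M]. *)
Variable act : 'M[F]_2 -> nat -> M -> M.

Local Notation Rn := {poly %/ ('X^n : {poly F})}.

(** Action of [x (x) p], [p] in [F[t]/t^n]. Pitfall: [{poly %/ 'X^n}] is this
    ring only for [n >= 1]. *)
Definition trunc_act (x : 'M[F]_2) (p : Rn) (u : M) : M :=
  \sum_(k < n) (val p)`_k *: act x k u.

(** The exponential of [T], for [T] nilpotent (so that [T^(dim M) = 0]). *)
Definition nilp_exp (T : M -> M) (u : M) : M :=
  \sum_(k < (\dim {:M}).+1) (k`!%:R)^-1 *: iter k T u.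

Definition elem_e (p : Rn) : 'M[Rn]_2 := 1%:M + p *: delta_mx 0 1.
Definition elem_f (p : Rn) : 'M[Rn]_2 := 1%:M + p *: delta_mx 1 0.

(** [SL2_acts g T]: the element [g] of [SL_2(F[t]/t^n)] acts on [M] by [T], in
    the representation of the group that integrates that of its Lie algebra
    ([F] is meant to be of characteristic 0): [exp(p e) = elem_e p] and
    [exp(p f) = elem_f p] act by the exponentials of [p e] and [p f], which act
    nilpotently on a finite-dimensional [M]. These elements generate
    [SL_2(F[t]/t^n)], see [SL2_acts_total]. *)
Inductive SL2_acts : 'M[Rn]_2 -> (M -> M) -> Prop :=
| SL2_acts_e p : SL2_acts (elem_e p) (nilp_exp (trunc_act (delta_mx 0 1) p))
| SL2_acts_f p : SL2_acts (elem_f p) (nilp_exp (trunc_act (delta_mx 1 0) p))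
| SL2_acts_mul g h S T :
    SL2_acts g S -> SL2_acts h T -> SL2_acts (g *m h) (fun u => S (T u)).

Lemma trunc_unitE (p : Rn) : (p \is a GRing.unit) = ((val p).[0] != 0).
Proof.
suff H (q : {poly F}) : coprimep (mk_monic 'X^n) q = (q.[0] != 0) by exact: H.
by rewrite mk_monic_Xn coprimep_pexpl // coprimep_sym coprimepX.
Qed.

Lemma trunc_horner0M (p q : Rn) :
  (val (p * q)).[0] = (val p).[0] * (val q).[0].
Proof.
have H (r : {poly F}) : (Pdiv.CommonRing.rmodp r (mk_monic 'X^n)).[0] = r.[0].
  rewrite [in RHS](Pdiv.RingMonic.rdivp_eq (monic_mk_monic 'X^n) r).
  by rewrite hornerD hornerM {3}mk_monic_Xn hornerXn expr0n mulr0 add0r.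
by rewrite -hornerM; apply: H.
Qed.

Lemma SL2_acts_total (g : 'M[Rn]_2) :
  \det g = 1 -> exists T, SL2_acts g T.
Proof.
have mulP (g1 g2 : 'M[Rn]_2) : (exists T, SL2_acts g1 T) ->
    (exists T, SL2_acts g2 T) -> exists T, SL2_acts (g1 *m g2) T.
  by move=> [S gS] [T hT]; exists (fun u => S (T u)); apply: SL2_acts_mul.
have eP (p : Rn) : exists T, SL2_acts (elem_e p) T.
  by eexists; apply: SL2_acts_e.
have fP (p : Rn) : exists T, SL2_acts (elem_f p) T.
  by eexists; apply: SL2_acts_f.
have unit_case (h : 'M[Rn]_2) : \det h = 1 -> h 1 0 \is a GRing.unit ->
    exists T, SL2_acts h T.
  move=> det1 /(SL2_elementary det1) ->.
  exact: (mulP _ _ (mulP _ _ (eP _) (fP _)) (eP _)).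
move=> det1; have [Uc|Nc] := boolP (g 1 0 \is a GRing.unit).
  exact: unit_case.
rewrite (SL2_shift g); apply: (mulP _ _ (fP _)); apply: unit_case.
  by rewrite SL2_shift_det.
rewrite SL2_shift10; move: det1 Nc; rewrite det_mx22 !trunc_unitE negbK.
move: (g 0 0) (g 0 1) (g 1 0) (g 1 1) => a b c d.
move=> det1 /eqP c0.
have : (val a).[0] * (val d).[0] == 1.
  have <- : (val (1 : Rn)).[0] = 1 by rewrite hornerC.
  by rewrite -det1 hornerD hornerN !trunc_horner0M c0 mulr0 subr0.
rewrite hornerD c0 addr0.
by apply: contraTneq => ->; rewrite mul0r eq_sym oner_eq0.
Qed.

Definition SL2_orbit (v : M) (L : proj M) : Prop :=
  exists g T, [/\ \det g = 1, SL2_acts g T & val L = <[T v]>%VS].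

End GroupAction.

Definition schubert (F : fieldType) (n : nat) (a : 'I_n -> nat) (z : 'I_n -> F)
    (L : proj (fusion a z)) : Prop :=
  zariski_closure (SL2_orbit n (@fusion_act F n a z) (fusion_vector a z)) L.

Arguments schubert {F n} a z L.

(** [A] is of type [s = {i_1, ..., i_r}]: it consists of [i_1] copies of some
    [c_1], then [i_2] copies of some [c_2], and so on, with [c_j != c_(j+1)]. *)
Definition of_type (A s : seq nat) : Prop :=
  all (leq 1) s /\
  exists c : seq nat,
    [/\ size c = size s, sorted (fun x y => x != y) c &
        A = flatten [seq nseq ic.1 ic.2 | ic <- zip s c]].

(* Main.v *)
(** Let [u(t) = \sum_k u_k t^k], with indeterminates [u_k]. The vector
    [exp(\sum_k u_k e_k) v_A] parametrizes a dense subset of the cone over [sh_A],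
    so [sh_A] is determined by the linear span [W_A] of its coordinates, a space of
    polynomials in the [u_k]. (The cone is stable under the whole group because the
    [f_k] act on that vector as vector fields in [u] plus a rescaling.)

    Before passing to the graded module the coordinates are the products of the
    [u(z_i)^(m_i)], [m_i < a_i]; on the graded module they are the initial forms of
    the combinations of those, for the weight [k] of [u_k]. The minors of the
    triangular [N x N] Hankel matrix [(u_(N-1-p-q))_(p, q)] are such initial forms for
    [A = (1, ..., 1, 2, ..., 2)] with [N] entries [2]. Let [P_A] be spanned by the
    products of one minor for each [N] in the multiset that contains [n - k] with
    multiplicity [a_(k+1) - a_k] ([a_0 = 1]). Then [P_A] is contained in [W_A], and
    [dim P_A >= a_1 ... a_n >= dim W_A], the first inequality by restricting to
    [u_0 = 0]; so [W_A = P_A], which does not depend on the [z_i].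

    If [B] has the type of [A], the two multisets have the same support, so for large
    [K] the [K]-fold products of [W_A] are the products of [W_B] with another such
    space: this gives forms of degree [K] defining a regular map [sh_A -> sh_B], and
    the same construction in the other direction gives its inverse. *)
From HB Require Import structures.
Require Import Defs.
From mathcomp Require Import all_boot all_order all_algebra.
From mathcomp Require Import perm qpoly.
From mathcomp Require Import boolp mpoly ring zify.
From mathcomp Require Import reals complex.

Set Implicit Arguments.
Unset Strict Implicit.
Unset Printing Implicit Defensive.

Import GRing.Theory.
Local Open Scope ring_scope.

(** * Hankel minors and the dimension of their products *)

(** The Hankel minors arise from weights kap_i on the last N points with sum_i kap_i z_i^d equal to
    0 for d < N - 1 and to 1 for d = N - 1. The matrix with entries sum_i kap_i z_i^(p+q) u(z_i) is
    of the form V^T D V with D diagonal in the u(z_i); by Cauchy-Binet its minors are combinations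
    of products of distinct u(z_i), so each minor raises an exponent by at most one, and only at the
    last N points. After a shift of the weights by p + q the lowest term of the entry (p, q) is
    u_(N-1-p-q), which gives the triangular matrix. Only the inclusion of P_A in W_A is constructed;
    the count then forces equality. Under restriction to u_0 = 0 the image contains the products for
    all sizes lowered by one, in the variables from u_1 on, and the kernel contains u_0 times the
    products with only the smallest size lowered. The two expected dimensions add up to the expected
    one. Identities between generating functions are reduced to their values at the origin: both
    sides range over families closed under partial derivatives, which suffices in characteristic
    0. *)

Section LinearSpan.
Variables (F : fieldType) (V : lmodType F).
Implicit Types (S T : V -> Prop) (x y : V).

Inductive lspan S : V -> Prop :=
| lspan0 : lspan S 0
| lspan_cons a x y : S x -> lspan S y -> lspan S (a *: x + y).

Lemma lspan_gen S x : S x -> lspan S x.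
Proof. by move=> Sx; rewrite -[x]scale1r -[_ *: _]addr0; constructor=> //; constructor. Qed.

Lemma lspanD S x y : lspan S x -> lspan S y -> lspan S (x + y).
Proof.
by elim=> [|a u v Su _ IH] Sy; rewrite ?add0r // -addrA; constructor=> //; apply: IH.
Qed.

Lemma lspanZ S a x : lspan S x -> lspan S (a *: x).
Proof.
elim=> [|b u v Su _ IH]; first by rewrite scaler0; constructor.
by rewrite scalerDr scalerA; constructor.
Qed.

Lemma lspan_sum S (I : Type) (r : seq I) (P : pred I) (E : I -> V) :
  (forall i, P i -> lspan S (E i)) -> lspan S (\sum_(i <- r | P i) E i).
Proof. by move=> SE; apply: big_ind => //; [constructor | apply: lspanD]. Qed.

Lemma lspan_sub S T x : (forall y, S y -> lspan T y) -> lspan S x -> lspan T x.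
Proof.
move=> ST; elim=> [|a u v Su _ IH]; first by constructor.
by apply: lspanD => //; apply: lspanZ; apply: ST.
Qed.

(** A linearly independent family of [d] vectors satisfying [S]; the
    polynomial spaces below do not live in a [vectType]. *)
Definition indep_in d S := exists f : 'I_d -> V, (forall i, S (f i)) /\
  forall c : 'I_d -> F, \sum_i c i *: f i = 0 -> forall i, c i = 0.

Lemma indep_sub d S T : (forall x, S x -> T x) -> indep_in d S -> indep_in d T.
Proof. by move=> ST [f [Sf ff]]; exists f; split=> // i; apply/ST. Qed.

End LinearSpan.

Lemma lspan_linear (F : fieldType) (U V : lmodType F) (f : {linear U -> V})
    (S : U -> Prop) (T : V -> Prop) x :
  (forall y, S y -> lspan T (f y)) -> lspan S x -> lspan T (f x).
Proof.
move=> ST; elim=> [|a u v Su _ IH]; first by rewrite linear0; constructor.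
by rewrite linearP; apply: lspanD => //; apply: lspanZ; apply: ST.
Qed.

Lemma lspanM (F : fieldType) (A : comAlgType F) (S T U : A -> Prop) x y :
  (forall u v, S u -> T v -> lspan U (u * v)) ->
  lspan S x -> lspan T y -> lspan U (x * y).
Proof.
move=> STU + Ty; elim=> [|a u v Su _ IH]; first by rewrite mul0r; constructor.
rewrite mulrDl; apply: lspanD => //; rewrite -scalerAl; apply: lspanZ.
elim: Ty => [|b u' v' Tu _ IH']; first by rewrite mulr0; constructor.
rewrite mulrDr; apply: lspanD => //; rewrite -scalerAr; apply: lspanZ.
exact: STU.
Qed.

(* The dimension count of the exact sequence
   ker rho -> W -> im rho, with [u * _] embedding [W1] into the kernel. *)
Lemma indep_extension (F : fieldType) (A : comAlgType F) (rho : {lrmorphism A -> A})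
    (u : A) (S S1 S2 : A -> Prop) d1 d2 :
  rho u = 0 -> (forall x, u * x = 0 -> x = 0) ->
  (forall x, S1 x -> S (u * x)) -> (forall x, S2 x -> exists2 y, S y & rho y = x) ->
  indep_in d1 S1 -> indep_in d2 S2 -> indep_in (d1 + d2) S.
Proof.
move=> rhou regu S1S S2S [f [S1f freef]] [h [S2h freeh]].
have /choice[g Sg] i : exists y, S y /\ rho y = h i.
  by have [y] := S2S _ (S2h i); exists y.
exists (fun i => match split i with inl j => u * f j | inr j => g j end).
split=> [i|c].
  by case: (split i) => j; [apply/S1S | case: (Sg j)].
rewrite big_split_ord /=.
under eq_bigr => i _ do rewrite (unsplitK (inl i)).
under [X in _ + X]eq_bigr => i _ do rewrite (unsplitK (inr i)).
move=> sum0.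
have c2 i : c (rshift d1 i) = 0.
  apply: (freeh (fun i => c (rshift d1 i))).
  have /(congr1 rho) := sum0; rewrite linear0 linearD !linear_sum /=.
  rewrite big1 ?add0r => [E|j _]; last by rewrite linearZ rmorphM /= rhou mul0r scaler0.
  by rewrite -[RHS]E; apply: eq_bigr => j _; rewrite linearZ /=; case: (Sg j) => _ ->.
have c1 i : c (lshift d2 i) = 0.
  apply: (freef (fun i => c (lshift d2 i))); apply: regu.
  rewrite mulr_sumr -[RHS]sum0 [X in _ = _ + X]big1 ?addr0 => [|j _].
    by apply: eq_bigr => j _; rewrite -scalerAr.
  by rewrite c2 scale0r.
by move=> i; rewrite -(splitK i); case: (split i) => j /=.
Qed.

Section HankelMinors.
Variables (F : fieldType) (n : nat).
Local Notation S := {mpoly F[n]}.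

Definition xvar (j : nat) : S := if insub j is Some i then 'X_i else 0.

Lemma xvarE (i : 'I_n) : xvar i = 'X_i.
Proof. by rewrite /xvar valK. Qed.

Lemma xvar_neq0 j : (j < n)%N -> xvar j != 0.
Proof.
move=> jn; rewrite (xvarE (Ordinal jn)) -msupp_eq0 msuppX //.
Qed.

(** The entries of the Hankel matrix [(u_(p + N - 1 - a - b))_(a, b)], with
    zeros where the index is less than [p]. *)
Definition hankel p N c : S := if (c < N)%N then xvar (p + (N - c.+1)) else 0.

(** The index maps are arbitrary, so the empty minor 1 and zero minors are included, and bordering
    or shifting a minor calls for no check on indices. *)
Definition hankel_minor p N (x : S) := exists r (al be : 'I_r -> nat),
  x = \det (\matrix_(i, j) hankel p N (al i + be j)).

Lemma hankel_minor1 p N : hankel_minor p N 1.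
Proof. by exists 0%N, (fun=> 0%N), (fun=> 0%N); rewrite det_mx00. Qed.

(** Border the matrix by the row of index [N] and the column of index 0, and shift the old columns
    by one. The new row is [xvar p] followed by zeros, and the shift turns the entries for [N.+1]
    into those for [N]. *)
Lemma hankel_minor_mulX p N x :
  hankel_minor p N x -> hankel_minor p N.+1 (xvar p * x).
Proof.
move=> [r [al [be ->]]].
pose al' (i : 'I_r.+1) := if unlift 0 i is Some k then al k else N.
pose be' (i : 'I_r.+1) := if unlift 0 i is Some k then (be k).+1 else 0%N.
exists r.+1, al', be'; rewrite (expand_det_row _ 0) big_ord_recl big1 ?addr0.
  rewrite mxE /al' /be' unlift_none addn0 /hankel ltnSn subnn addn0.
  congr (_ * _); rewrite /cofactor expr0 mul1r; congr (\det _).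
  apply/matrixP => i j; rewrite !mxE !liftK /hankel addnS ltnS.
  by case: ifP => // lt; rewrite subSS.
move=> j _; rewrite mxE /al' /be' unlift_none; have:= liftK 0 j.
by rewrite /= => ->; rewrite /hankel ltnS addnS ltnNge leq_addr mul0r.
Qed.

Definition kill p : S -> S := mmap (@mpolyC n F) (fun i => if i == p :> nat then 0 else 'X_i).

HB.instance Definition _ p := GRing.RMorphism.on (kill p).

Lemma kill_scalable p : scalable (kill p).
Proof. by move=> a x; rewrite /kill mmapZ mul_mpolyC. Qed.
HB.instance Definition _ p := GRing.isScalable.Build F S S *:%R (kill p) (kill_scalable p).

Lemma kill_xvar p j : kill p (xvar j) = if j == p then 0 else xvar j.
Proof.
rewrite /xvar; case: insubP => [i _ <-|_] /=; last by rewrite rmorph0 if_same.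
by rewrite /kill mmapX mmap1U.
Qed.

(** Only the antidiagonal [c = N] carries the variable of index [p]; what remains is the triangular
    matrix one size smaller, in the variables from [p.+1] on. *)
Lemma kill_hankel p N c : kill p (hankel p N.+1 c) = hankel p.+1 N c.
Proof.
rewrite /hankel ltnS leq_eqVlt; have [->|cN] := eqVneq c N.
  by rewrite ltnn subnn addn0 kill_xvar eqxx.
case: ltnP => lt /=; last by rewrite rmorph0.
rewrite kill_xvar; case: eqP => [|_]; first lia.
congr xvar; lia.
Qed.

Lemma hankel_minor_kill p N x : hankel_minor p.+1 N x ->
  exists2 y, hankel_minor p N.+1 y & kill p y = x.
Proof.
move=> [r [al [be ->]]].
exists (\det (\matrix_(i, j) hankel p N.+1 (al i + be j))).
  by exists r, al, be.
rewrite -det_map_mx; congr (\det _).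
by apply/matrixP => i j; rewrite !mxE -kill_hankel.
Qed.

Fixpoint hankel_prod p (Ns : seq nat) (x : S) : Prop :=
  if Ns is N :: Ns' then
    exists y z, [/\ hankel_minor p N y, hankel_prod p Ns' z & x = y * z]
  else x = 1.

Lemma hankel_prod_kill p Ns x : hankel_prod p.+1 Ns x ->
  exists2 y, hankel_prod p (map succn Ns) y & kill p y = x.
Proof.
elim: Ns x => [x ->|N Ns IH x [y [z [/hankel_minor_kill[y' yN <-] + ->]]]] /=.
  by exists 1; rewrite ?rmorph1.
by move=> /IH[z' zN <-]; exists (y' * z'); rewrite ?rmorphM //; exists y', z'.
Qed.

(** For the multiset attached to [A] the factor [j] is the entry of [A] at position [n - 1 - j],
    counted from 0, so this is the product of the entries, see [hankel_dim_prod]. *)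
Definition hankel_dim (Ns : seq nat) : nat :=
  (\prod_(j < n) (count (fun N => j < N) Ns).+1)%N.

(** Let r be the number of sizes. As [N.+1] is the smallest of them, the factors 0 to [N] on the
    left all equal r + 1. Lowering the smallest size alone turns one of these into r, lowering all
    sizes removes one of them, and r/(r+1) + 1/(r+1) = 1. *)
Lemma hankel_dimS N Ns : all (leq N) Ns -> (N < n)%N ->
    all (fun N => N <= n)%N (map succn (N :: Ns)) ->
  hankel_dim (map succn (N :: Ns)) =
    (hankel_dim (N :: map succn Ns) + hankel_dim (N :: Ns))%N.
Proof.
move=> leN Nn; set Ns1 := map succn Ns => /= /andP[_ Ns1n].
have [m mn] : exists m, n = m.+1 by exists n.-1; rewrite prednK // (leq_ltn_trans _ Nn).
pose c j := (count (fun N => j < N)%N (N.+1 :: Ns1)).+1.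
have cN j : (j <= N)%N -> c j = (size Ns).+2.
  move=> jN; rewrite /c /= ltnS jN add1n; congr _.+2.
  rewrite -(size_map succn Ns); apply/eqP; rewrite -all_count all_map.
  by apply: sub_all leN => k /=; rewrite ltnS; apply: leq_trans.
have dS : hankel_dim (N :: Ns) = (\prod_(1 <= j < n.+1) c j)%N.
  rewrite /hankel_dim -(big_mkord xpredT (fun j => (count (fun N => j < N)%N (N :: Ns)).+1)).
  rewrite [RHS]big_add1; apply: eq_bigr => j _; congr _.+1.
  by rewrite /= /Ns1 count_map.
have cn : c n = 1%N.
  rewrite /c /= ltnS leqNgt Nn add0n; congr _.+1; apply/eqP.
  by rewrite -leqn0 leqNgt -has_count -all_predC; apply: sub_all Ns1n => k /=; rewrite -leqNgt.
have dE : hankel_dim (N.+1 :: Ns1) = ((size Ns).+2 * hankel_dim (N :: Ns))%N.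
  rewrite dS big_nat_recr ?(leq_ltn_trans _ Nn) //= cn muln1 -(cN 0%N) // -big_ltn ?(leq_ltn_trans _ Nn) //.
  by rewrite /hankel_dim -(big_mkord xpredT c).
pose Q := (\prod_(j < n | j != Ordinal Nn) c j)%N.
have QE : hankel_dim (N.+1 :: Ns1) = ((size Ns).+2 * Q)%N.
  rewrite /hankel_dim (bigD1 (Ordinal Nn)) //=; congr (_ * _)%N.
  exact: (cN N).
have -> : hankel_dim (N :: Ns1) = ((size Ns).+1 * Q)%N.
  rewrite /hankel_dim (bigD1 (Ordinal Nn)) //=; congr (_ * _)%N.
    have := cN N (leqnn N); rewrite /c /= ltnn ltnSn; lia.
  apply: eq_bigr => j; rewrite /c /= -val_eqE /= => jN; congr (_ + _).+1.
  by rewrite [in RHS]ltnS [in RHS]leq_eqVlt (negPf jN).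
have QS : Q = hankel_dim (N :: Ns).
  by apply/eqP; rewrite -(@eqn_pmul2l (size Ns).+2) // -QE dE.
rewrite dE QS; lia.
Qed.

(** Induction along the restriction [kill p]. For the kernel the smallest size is lowered, which
    keeps the list sorted and fits [hankel_dimS]; for the image all sizes are lowered and [p] is
    raised. A size 0 is dropped, with 1 as its minor; this step is why the length enters the
    measure. *)
Lemma hankel_prod_indep p Ns : sorted leq Ns -> all (fun N => p + N <= n)%N Ns ->
  indep_in (hankel_dim Ns) (lspan (hankel_prod p Ns)).
Proof.
have [k] := ubnP (sumn Ns + size Ns); elim: k => // k IH in p Ns *.
case: Ns => [_ _ _|[|N] Ns].
- rewrite /hankel_dim big1 //=; exists (fun=> 1); split=> [i|c].
    by apply: lspan_gen.
  rewrite big_ord1 => /(congr1 (mcoeff 0)); rewrite mcoeffZ mcoeff1 eqxx mulr1.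
  by rewrite mcoeff0 => c0 i; rewrite ord1.
- move=> lek sN leN.
  have -> : hankel_dim (0%N :: Ns) = hankel_dim Ns.
    by apply: eq_bigr => j _.
  apply: indep_sub (IH p Ns _ _ _); first last.
  + by case/andP: leN.
  + exact: path_sorted sN.
  + by move: lek; rewrite /=; lia.
  move=> x; apply: lspan_sub => y y_prod; apply: lspan_gen.
  by exists 1, y; split; rewrite ?mul1r //; apply: hankel_minor1.
move=> lek sN leN.
pose Ms := map predn Ns.
have N_le : all (leq N.+1) Ns by move: sN; rewrite /= (path_sortedE leq_trans) => /andP[].
have NsE : Ns = map succn Ms.
  rewrite -map_comp map_id_in // => i /(allP N_le) /=; lia.
rewrite NsE; rewrite NsE in sN leN lek N_le; move: (Ms) sN leN lek N_le => {Ns NsE}Ms sN leN lek N_le.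
have N_Ms : all (leq N) Ms by move: N_le; rewrite all_map; apply: sub_all => i /=; lia.
have pNn : (p + N.+1 <= n)%N by case/andP: leN.
rewrite -/(map succn (N :: Ms)) hankel_dimS //; first last.
- apply: sub_all leN => i /=; lia.
- lia.
have pn : (p < n)%N by lia.
apply: (@indep_extension _ _ (kill p) (xvar p) _
         (lspan (hankel_prod p (N :: map succn Ms)))
         (lspan (hankel_prod p.+1 (N :: Ms)))).
- by have := kill_xvar p p; rewrite eqxx.
- by move=> x /eqP; rewrite mulf_eq0 (negPf (xvar_neq0 pn)) => /eqP.
- move=> x; apply: (@lspanM _ _ (eq (xvar p)) _ _ (xvar p)); last exact: lspan_gen.
  move=> _ _ <- [a [b [aN bN ->]]]; apply: lspan_gen; exists (xvar p * a), b.
  by split=> //=; rewrite ?mulrA //; apply: hankel_minor_mulX.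
- move=> x; elim=> [|a u v Su _ [y Py <-]].
    by exists 0; [constructor | rewrite rmorph0].
  have [z Pz <-] := hankel_prod_kill Su.
  by exists (a *: z + y); [constructor | rewrite linearP].
- apply: IH; first by move: lek; rewrite /=; lia.
  + move: sN; rewrite /= !(path_sortedE leq_trans) => /andP[_ ->].
    by rewrite andbT all_map; apply: sub_all N_Ms => i /=; lia.
  + move: leN => /= /andP[le1 ->]; lia.
apply: IH.
- have : sumn (map succn Ms) = (sumn Ms + size Ms)%N.
    by elim: (Ms) => //= a s ->; lia.
  by move: lek; rewrite /= size_map; lia.
- move: sN; rewrite /= !(path_sortedE leq_trans) N_Ms /= => /andP[_].
  by rewrite sorted_map.
by move: leN => /= /andP[le1]; rewrite all_map => leM; apply/andP; split; [lia|apply: sub_all leM => i /=; lia].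
Qed.

End HankelMinors.

(** * Regular maps given by dominating families *)

Section Substitution.
Variable F : fieldType.

Definition subst m k (w : 'I_m -> {mpoly F[k]}) (p : {mpoly F[m]}) : {mpoly F[k]} :=
  mmap (@mpolyC k F) w p.

HB.instance Definition _ m k w :=
  GRing.RMorphism.copy (@subst m k w) (mmap (@mpolyC k F) w).

Lemma substZ m k (w : 'I_m -> {mpoly F[k]}) a p : subst w (a *: p) = a *: subst w p.
Proof. by rewrite /subst mmapZ mul_mpolyC. Qed.

Lemma substX m k (w : 'I_m -> {mpoly F[k]}) i : subst w 'X_i = w i.
Proof. by rewrite /subst mmapX mmap1U. Qed.

Lemma substM m k (w : 'I_m -> {mpoly F[k]}) p q : subst w (p * q) = subst w p * subst w q.
Proof. exact: rmorphM. Qed.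

Lemma subst_sum m k (w : 'I_m -> {mpoly F[k]}) (I : Type) (r : seq I) P E :
  subst w (\sum_(i <- r | P i) E i) = \sum_(i <- r | P i) subst w (E i).
Proof. exact: raddf_sum. Qed.

Lemma substE m k (w : 'I_m -> {mpoly F[k]}) p :
  subst w p = \sum_(mm <- msupp p) p@_mm *: \prod_i w i ^+ mm i.
Proof. by apply: eq_bigr => mm _; rewrite mul_mpolyC. Qed.

Lemma subst_meval m k (w : 'I_m -> {mpoly F[k]}) p v :
  (subst w p).@[v] = p.@[fun i => (w i).@[v]].
Proof.
rewrite substE [in RHS]mevalE raddf_sum /=; apply: eq_bigr => mm _.
rewrite mevalZ rmorph_prod; congr (_ * _).
by apply: eq_bigr => i _; rewrite rmorphXn.
Qed.

Lemma subst_subst m k l (v : 'I_m -> {mpoly F[k]}) (w : 'I_k -> {mpoly F[l]}) p :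
  subst w (subst v p) = subst (fun i => subst w (v i)) p.
Proof.
rewrite [subst v p]substE [RHS]substE raddf_sum /=; apply: eq_bigr => mm _.
rewrite substZ rmorph_prod; congr (_ *: _).
by apply: eq_bigr => i _; rewrite rmorphXn.
Qed.

Lemma mmap_homogM m (S : comNzRingType) (f : F -> S) (v : 'I_m -> S) (g : S) d p :
  p \is d.-homog -> mmap f (fun i => v i * g) p = g ^+ d * mmap f v p.
Proof.
move=> /dhomogP homp; rewrite /mmap big_distrr /= !big_seq.
apply: eq_bigr => mm /homp dm; rewrite /mmap1 mulrCA; congr (_ * _).
under eq_bigr do rewrite exprMn.
by rewrite big_split /= mulrC -dm prodrXr -mdegE mulrC.
Qed.

Lemma dhomogXU m (i : 'I_m) : ('X_i : {mpoly F[m]}) \is 1.-homog.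
Proof. by rewrite dhomogX; apply/eqP/mdeg1. Qed.

Lemma subst_homog m k d e (w : 'I_m -> {mpoly F[k]}) p :
  (forall i, w i \is e.-homog) -> p \is d.-homog -> subst w p \is (e * d).-homog.
Proof.
move=> homw /dhomogP homp; rewrite substE big_seq.
apply: rpred_sum => mm /homp <-; apply: dhomogZ.
rewrite -[X in (e * X)%N]/(mdeg mm) mdegE big_distrr /=.
apply: (big_ind2 (fun (q : {mpoly F[k]}) c => q \is c.-homog)).
- exact: dhomog1.
- by move=> *; apply: dhomogM.
- by move=> i _; apply: dhomogMn.
Qed.

End Substitution.

Section Lines.
Variable (F : fieldType) (M : vectType F).
Local Notation D := (\dim {:M}).

Lemma proj_gen (L : proj M) : exists2 u, u != 0 & val L = <[u]>%VS.
Proof.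
have /eqP dL := valP L; have L0 : (val L != 0)%VS.
  by apply: contra_eq_neq dL => ->; rewrite dimv0.
exists (vpick (val L)); first by rewrite vpick0.
apply/eqP; rewrite eq_sym eqEdim dL dim_vline vpick0 L0 andbT.
by rewrite -memvE memv_pick.
Qed.

Lemma line_proj (u : M) : u != 0 -> exists L : proj M, val L = <[u]>%VS.
Proof.
move=> u0; have dL : \dim <[u]>%VS == 1%N by rewrite dim_vline u0.
by exists (exist _ <[u]>%VS dL).
Qed.

Lemma proj_line_eq (L : proj M) u : u \in val L -> u != 0 -> val L = <[u]>%VS.
Proof.
move=> uL u0; apply/eqP; rewrite eq_sym eqEdim dim_vline u0 -memvE uL.
by rewrite (eqP (valP L)).
Qed.

Definition xcoord (i : 'I_D) (u : M) : F := coord (vbasis {:M}) i u.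

Lemma xcoord_is_scalar i : scalar (xcoord i).
Proof. by move=> a u v; rewrite /xcoord linearP. Qed.
HB.instance Definition _ i :=
  GRing.isLinear.Build F M F *%R (xcoord i) (xcoord_is_scalar i).

Lemma xcoord_sum u : u = \sum_i xcoord i u *: (vbasis {:M})`_i.
Proof. exact/coord_vbasis/memvf. Qed.

Lemma xcoord_lin (c : 'I_D -> F) i : xcoord i (\sum_j c j *: (vbasis {:M})`_j) = c i.
Proof. by rewrite /xcoord coord_sum_free // (basis_free (vbasisP _)). Qed.

Lemma xcoord_neq0 u : u != 0 -> exists i, xcoord i u != 0.
Proof.
move=> u0; apply/existsP; apply: contra_neqT u0 => /existsPn x0.
by rewrite [u]xcoord_sum big1 // => i _; have /negPn/eqP -> := x0 i; rewrite scale0r.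
Qed.

Lemma proportional_line u v : v != 0 ->
  (forall i j, xcoord i u * xcoord j v = xcoord j u * xcoord i v) -> u \in <[v]>%VS.
Proof.
move=> /xcoord_neq0[j vj] uv; apply/vlineP; exists (xcoord j u / xcoord j v).
rewrite [LHS]xcoord_sum [X in _ *: X]xcoord_sum scaler_sumr; apply: eq_bigr => i _.
by rewrite scalerA mulrAC -uv mulfK.
Qed.

Lemma poly_evalZ d (p : {mpoly F[D]}) a u :
  p \is d.-homog -> poly_eval p (a *: u) = a ^+ d * poly_eval p u.
Proof.
move=> homp; rewrite /poly_eval -(mmap_homogM _ _ _ homp); apply: meval_eq => i.
by rewrite linearZ mulrC.
Qed.

Lemma vanishes_line d (p : {mpoly F[D]}) (L : proj M) u : p \is d.-homog ->
  val L = <[u]>%VS -> vanishes p L <-> poly_eval p u = 0.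
Proof.
move=> homp Lu; split=> [/(_ u)|p0 v]; rewrite Lu ?memv_line; first exact.
by case/vlineP=> a ->; rewrite (poly_evalZ _ _ homp) p0 mulr0.
Qed.

End Lines.

Section Cone.
Variables (F : fieldType) (n : nat) (M : vectType F).
Variable w : 'I_(\dim {:M}) -> {mpoly F[n]}.

(** [w] parametrizes a subset of the affine cone; the points of the closure are
    those where all the homogeneous relations between the [w i] vanish. *)
Definition in_cone (u : M) := forall d (p : {mpoly F[\dim {:M}]}),
  p \is d.-homog -> subst w p = 0 -> poly_eval p u = 0.

Definition in_closure (L : proj M) := forall u, u \in val L -> in_cone u.

Lemma in_closure_line (L : proj M) u : val L = <[u]>%VS -> in_closure L <-> in_cone u.
Proof.
move=> Lu; split=> [/(_ u)|cu v]; rewrite Lu ?memv_line; first exact.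
move=> /vlineP[a ->] d p homp wp.
by rewrite (poly_evalZ _ _ homp) (cu d) ?mulr0.
Qed.

End Cone.

Section ProjectiveMap.
Variables (F : fieldType) (n : nat) (M N : vectType F).
Local Notation S := {mpoly F[n]}.
Variables (w : 'I_(\dim {:M}) -> S) (w' : 'I_(\dim {:N}) -> S).

Definition represents K (g : S) (p : 'I_(\dim {:N}) -> {mpoly F[\dim {:M}]}) :=
  forall i, p i \is K.-homog /\ subst w (p i) = w' i * g.

(** Multiplying the family [w'] by the elements of [G] gives forms of degree [K]
    in the [w i], without common zeros where the [w i] have none. *)
Definition dominates K (G : S -> Prop) :=
  (forall g, G g -> exists p, represents K g p) /\
  (forall j, lspan (fun x => exists i g, G g /\ x = w' i * g) (w j ^+ K)).

Definition poly_map (p : 'I_(\dim {:N}) -> {mpoly F[\dim {:M}]}) (u : M) : N :=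
  \sum_i poly_eval (p i) u *: (vbasis {:N})`_i.

Lemma xcoord_poly_map p u i : xcoord i (poly_map p u) = poly_eval (p i) u.
Proof. exact: xcoord_lin. Qed.

Lemma poly_eval_map p u q : poly_eval q (poly_map p u) = poly_eval (subst p q) u.
Proof. by rewrite /poly_eval subst_meval; apply: meval_eq => i; apply: xcoord_poly_map. Qed.

(** The condition involves all representing families at once; a family that vanishes at [u] only
    says there that 0 lies in [L']. *)
Definition represented K (G : S -> Prop) (L : proj M) (L' : proj N) :=
  forall g p, G g -> represents K g p ->
  forall u, u \in val L -> poly_map p u \in val L'.

Lemma subst_represents K g p d q : represents K g p -> q \is d.-homog ->
  subst w (subst p q) = g ^+ d * subst w' q.
Proof.
move=> rep homq; rewrite subst_subst -(mmap_homogM _ _ _ homq).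
congr mmap; apply/funext => i; exact: (rep i).2.
Qed.

Lemma cone_poly_map K g p u : represents K g p -> in_cone w u -> in_cone w' (poly_map p u).
Proof.
move=> rep cu d q homq wq; rewrite poly_eval_map; apply: (cu (K * d)%N).
  by apply: subst_homog => // i; apply: (rep i).1.
by rewrite (subst_represents rep homq) wq mulr0.
Qed.

(** After substitution of [w] both sides become [w' i * w' j * g * g'], so their difference is a
    relation and vanishes on the cone. Hence two families define the same point wherever both are
    nonzero. *)
Lemma represents_prop K g g' p p' u i j : represents K g p -> represents K g' p' ->
  in_cone w u ->
  poly_eval (p i) u * poly_eval (p' j) u = poly_eval (p j) u * poly_eval (p' i) u.
Proof.
move=> rep rep' cu; apply/eqP; rewrite -subr_eq0 /poly_eval -!mevalM -mevalB.
apply/eqP/(cu (K + K)%N).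
  by rewrite rpredB // dhomogM // ?(rep _).1 ?(rep' _).1.
rewrite rmorphB !rmorphM /= !(rep _).2 !(rep' _).2; ring.
Qed.

(** If every family vanished at [u], so would each ['X_j ^+ K]: on the cone it agrees with a
    combination of the forms [p i], because [w j ^+ K] lies in the span of the [w' i * g]. Then [u]
    would be 0. *)
Lemma dominates_nonzero K G u : dominates K G -> in_cone w u -> u != 0 ->
  exists g p, [/\ G g, represents K g p & poly_map p u != 0].
Proof.
move=> [repG spanK] cu u0; apply: contrapT => none.
have {none} allz g p : G g -> represents K g p -> poly_map p u = 0.
  move=> Gg rep; apply/eqP/negPn/negP => pu; apply: none.
  by exists g, p.
have [j uj] := xcoord_neq0 u0.
have [q [homq wq qu]] : exists q : {mpoly F[\dim {:M}]},
    [/\ q \is K.-homog, subst w q = w j ^+ K & poly_eval q u = 0].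
  elim: (spanK j) => [|a x y [i [g [Gg ->]]] _ [q [homq <- qu]]].
    by exists 0; rewrite rmorph0 /poly_eval meval0; split=> //; apply: dhomog0.
  have [p rep] := repG g Gg; exists (a *: p i + q); split.
  - by apply: dhomogD => //; apply: dhomogZ; apply: (rep i).1.
  - by rewrite rmorphD /= substZ (rep i).2.
  have := xcoord_poly_map p u i; rewrite (allz g p) // linear0 => pi.
  by rewrite /poly_eval mevalD mevalZ -/(poly_eval _ u) -pi mulr0 add0r.
have: poly_eval ('X_j ^+ K - q) u = 0.
  apply: (cu K).
    by rewrite rpredB // -{2}[K]mul1n dhomogMn // dhomogXU.
  by rewrite rmorphB rmorphXn /= substX wq subrr.
rewrite /poly_eval mevalB rmorphXn /= mevalXU -/(poly_eval q u) qu subr0.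
by move/eqP; rewrite expf_eq0 (negPf uj) andbF.
Qed.

Lemma represented_ex K G L : dominates K G -> in_closure w L ->
  exists L', in_closure w' L' /\ represented K G L L'.
Proof.
move=> dom clL; have [u u0 Lu] := proj_gen L.
have cu : in_cone w u by apply/(in_closure_line _ Lu).
have [g0 [p0 [G0 rep0 pu0]]] := dominates_nonzero dom cu u0.
have [L' L'E] := line_proj pu0; exists L'; split.
  by apply/(in_closure_line _ L'E)/cone_poly_map; first exact: rep0.
move=> g p Gg rep v; rewrite Lu L'E => /vlineP[a ->].
apply: proportional_line => // i j; rewrite !xcoord_poly_map.
rewrite !(poly_evalZ _ _ (rep _).1) -!mulrA; congr (_ * _).
exact: (represents_prop _ _ rep rep0 cu).
Qed.

Lemma represented_regular K G (X : proj M -> Prop) (phi : proj M -> proj N) :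
  dominates K G -> (forall L, X L -> in_closure w L /\ represented K G L (phi L)) ->
  regular_on X phi.
Proof.
move=> dom Xphi L XL; have [clL _] := Xphi L XL; have [u u0 Lu] := proj_gen L.
have cu : in_cone w u by apply/(in_closure_line _ Lu).
have [g [p [Gg rep pu]]] := dominates_nonzero dom cu u0.
exists K, p; split=> [i||L' XL' _ v vL']; first exact: (rep i).1.
  have [i pui] := xcoord_neq0 pu; exists i => /(vanishes_line (rep i).1 Lu) p0.
  by move: pui; rewrite xcoord_poly_map p0 eqxx.
by have [_] := Xphi L' XL'; apply; first exact: Gg.
Qed.

End ProjectiveMap.

Section Isomorphism.
Variables (F : fieldType) (n : nat).
Local Notation S := {mpoly F[n]}.

(** Substituting [w] into the composite of two families gives [g ^+ K' * (w i * h)]: its values have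
    the coordinates of [u] up to a common factor, and so span [L] again. *)
Lemma represented_inverse (M N : vectType F)
    (w : 'I_(\dim {:M}) -> S) (w' : 'I_(\dim {:N}) -> S) K K' G G' L L' L'' :
  dominates w w' K G -> dominates w' w K' G' -> in_closure w L -> in_closure w' L' ->
  represented w w' K G L L' -> represented w' w K' G' L' L'' -> L'' = L.
Proof.
move=> dom dom' clL clL' LL' LL''; have [u u0 Lu] := proj_gen L.
have cu : in_cone w u by apply/(in_closure_line _ Lu).
have [g [p [Gg rep pu]]] := dominates_nonzero dom cu u0.
have pL' : poly_map p u \in val L' by apply: (LL' g) => //; rewrite Lu memv_line.
have [h [r [Gh rep' ru]]] := dominates_nonzero dom' (clL' _ pL') pu.
have rL'' := LL'' h r Gh rep' _ pL'.
apply/val_inj; rewrite (proj_line_eq rL'' ru).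
apply/esym/proj_line_eq; rewrite // Lu; apply: proportional_line => // i j.
rewrite !xcoord_poly_map !poly_eval_map.
rewrite /xcoord -[coord _ j u](mevalXU (fun i => coord (vbasis {:M}) i u)).
rewrite -[coord _ i u](mevalXU (fun i => coord (vbasis {:M}) i u)) -!mevalM.
apply/eqP; rewrite -subr_eq0 -mevalB; apply/eqP/(cu (K * K' + 1)%N).
  by rewrite rpredB // dhomogM ?dhomogXU //; apply: subst_homog => [k|];
     rewrite ?(rep _).1 ?(rep' _).1.
rewrite rmorphB !rmorphM /= !substX !(subst_represents rep (rep' _).1).
rewrite !(rep' _).2; ring.
Qed.

(** [L0] and [L0'] supply the values of the two total maps off the closures. *)
Lemma closure_isomorphic (M N : vectType F) (L0 : proj M) (L0' : proj N)
    (w : 'I_(\dim {:M}) -> S) (w' : 'I_(\dim {:N}) -> S) K K' G G'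
    (X : proj M -> Prop) (Y : proj N -> Prop) :
  (forall L, X L <-> in_closure w L) -> (forall L, Y L <-> in_closure w' L) ->
  dominates w w' K G -> dominates w' w K' G' -> proj_isomorphic X Y.
Proof.
move=> XE YE dom dom'.
have map_ex (M1 N1 : vectType F) (w1 : 'I_(\dim {:M1}) -> S) (w2 : 'I_(\dim {:N1}) -> S)
    K1 G1 : proj N1 -> dominates w1 w2 K1 G1 -> exists phi, forall L, in_closure w1 L ->
    in_closure w2 (phi L) /\ represented w1 w2 K1 G1 L (phi L).
  move=> Ld dom1.
  have /choice[phi] L : exists L', in_closure w1 L ->
      in_closure w2 L' /\ represented w1 w2 K1 G1 L L'; last by exists phi.
  have [/(represented_ex dom1)[L' ?]|] := pselect (in_closure w1 L); first by exists L'.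
  by exists Ld.
have [phi phiP] := map_ex _ _ _ _ _ _ L0' dom.
have [psi psiP] := map_ex _ _ _ _ _ _ L0 dom'.
exists phi, psi; split.
- split=> L; first by move=> /XE/phiP[/YE].
  by move=> /YE/psiP[/XE].
- move=> L /XE clL; have [cl1 rep1] := phiP L clL; have [_ rep2] := psiP _ cl1.
  exact: (represented_inverse dom dom' clL cl1 rep1 rep2).
- move=> L /YE clL; have [cl1 rep1] := psiP L clL; have [_ rep2] := phiP _ cl1.
  exact: (represented_inverse dom' dom clL cl1 rep1 rep2).
- by apply: (represented_regular dom) => L /XE clL; split=> //; case: (phiP L clL).
- by apply: (represented_regular dom') => L /YE clL; split=> //; case: (psiP L clL).
Qed.

End Isomorphism.

(** * Polynomials in characteristic zero *)

Lemma mderiv_var (R : nzRingType) m (i k : 'I_m) : ('X_i : {mpoly R[m]})^`M(k) = (i == k)%:R.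
Proof.
rewrite mderivX mnm1E; case: eqVneq => [->|_]; last by rewrite scale0r.
have -> : (U_(k) - U_(k) = 0 :> 'X_{1..m})%MM.
  by apply/mnmP => j; rewrite mnmBE mnm0E subnn.
by rewrite scale1r mpolyX0.
Qed.

Section ChainRule.
Variables (F : fieldType) (m : nat) (A : comNzRingType) (f : {rmorphism F -> A}).
Variables (h : 'I_m -> A) (delta : A -> A).
Hypothesis deltaD : {morph delta : x y / x + y}.
Hypothesis deltaM : forall x y, delta (x * y) = delta x * y + x * delta y.
Hypothesis deltaC : forall c, delta (f c) = 0.

(** An arbitrary derivation [delta] covers the three cases that occur: the derivative in one
    variable, partial derivatives after a substitution, and partial derivatives applied
    coefficientwise to a polynomial over [{mpoly F[n]}]. *)
Lemma mmap_chain_rule p :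
  delta (mmap f h p) = \sum_i mmap f h p^`M(i) * delta (h i).
Proof.
have delta0 : delta 0 = 0 by rewrite -[X in delta X](rmorph0 f) deltaC.
pose P (q : {mpoly F[m]}) :=
  delta (mmap f h q) = \sum_i mmap f h q^`M(i) * delta (h i).
have PC c : P c%:MP.
  by rewrite /P mmapC deltaC big1 // => i _; rewrite mderivC mmap0 mul0r.
have PD q r : P q -> P r -> P (q + r).
  rewrite /P mmapD deltaD => -> ->; rewrite -big_split; apply: eq_bigr => i _.
  by rewrite mderivD mmapD mulrDl.
have PM q r : P q -> P r -> P (q * r).
  rewrite /P rmorphM /= deltaM => -> ->; rewrite mulr_suml mulr_sumr -big_split.
  by apply: eq_bigr => i _; rewrite /= mderivM mmapD !rmorphM /=; ring.
have PX i : P 'X_i.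
  rewrite /P mmapX mmap1U (bigD1 i) //= big1 => [|j ji].
    by rewrite mderiv_var eqxx rmorph1 mul1r addr0.
  by rewrite mderiv_var eq_sym (negPf ji) rmorph0 mul0r.
rewrite -/(P p); elim/mpolyind: p => [|c mm p _ _ Pp].
  by rewrite -mpolyC0; apply: PC.
apply/PD => //; rewrite -mul_mpolyC; apply/PM => //.
rewrite mpolyXE_id; apply: (big_ind P) => [||i _]; [by rewrite -mpolyC1; apply: PC|exact: PM|].
by elim: (mm i) => [|k IH]; rewrite ?exprS ?expr0; [rewrite -mpolyC1; apply: PC|apply: PM].
Qed.

End ChainRule.

Section CharZero.
Variable F : fieldType.
Hypothesis F0 : [pchar F] =i pred0.

Lemma natrS_neq0 k : k.+1%:R != 0 :> F.
Proof. by rewrite ((pcharf0P F).1 F0). Qed.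

Lemma factr_neq0 k : k`!%:R != 0 :> F.
Proof. by rewrite ((pcharf0P F).1 F0) -lt0n fact_gt0. Qed.

Lemma poly_derivn_eq0 (p : {poly F}) : (forall k, p^`(k).[0] = 0) -> p = 0.
Proof.
move=> p0; apply/polyP => k; rewrite coef0.
have := p0 k; rewrite horner_coef0 coef_derivn addn0 ffactnn => /eqP.
by rewrite -mulr_natr mulf_eq0 (negPf (factr_neq0 k)) orbF => /eqP.
Qed.

Lemma poly_eval_eq0 (p : {poly F}) : (forall c, p.[c] = 0) -> p = 0.
Proof.
move=> p0; apply/eqP; apply: contraT => pn0.
have inj : injective (fun k : nat => k%:R : F).
  move=> i j /eqP; wlog ij : i j / (i <= j)%N => [H ij|].
    by case: (leqP i j) => [/H|/ltnW/H->] //; [apply | rewrite eq_sym].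
  rewrite eq_sym -subr_eq0 -natrB // ((pcharf0P F).1 F0) subn_eq0 => ji.
  by apply/eqP; rewrite eqn_leq ij.
have := @max_poly_roots _ p [seq k%:R | k <- iota 0 (size p)] pn0.
rewrite size_map size_iota ltnn map_inj_uniq // iota_uniq => -> //.
by apply/allP => x _; apply/eqP.
Qed.

(* A family of polynomials vanishing at the origin and closed under partial
   derivatives is zero: this is how identities between generating functions are
   checked below. *)
Lemma mpoly_taylor_eq0 m (Z : {mpoly F[m]} -> Prop) :
  (forall p, Z p -> p@_0 = 0) -> (forall p i, Z p -> Z p^`M(i)) ->
  forall p, Z p -> p = 0.
Proof.
move=> Z0 Zd p Zp; apply/mpolyP => mm; rewrite mcoeff0.
have [k] := ubnP (mdeg mm); elim: k => // k IH in mm p Zp *; rewrite ltnS => mk.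
have [->|] := eqVneq mm 0%MM; first exact: Z0.
rewrite -mdeg_eq0 mdegE sum_nat_eq0 negb_forall => /existsP[i /= mi].
have mE : mm = ((mm - U_(i)) + U_(i))%MM.
  by apply/mnmP => j; rewrite mnmDE mnmBE mnm1E; case: eqVneq => [<-|]; lia.
have := IH (mm - U_(i))%MM _ (Zd _ i Zp); rewrite mcoeff_deriv -mE => /(_ _)/eqP.
rewrite -mulr_natr mulf_eq0 (negPf (natrS_neq0 _)) orbF => H; apply/eqP/H.
by move: mk; rewrite {1}mE mdegD mdeg1; lia.
Qed.

Lemma horner_mmap m (h : 'I_m -> {poly F}) p c :
  (mmap (@polyC F) h p).[c] = p.@[fun i => (h i).[c]].
Proof.
rewrite /mmap mevalE horner_sum; apply: eq_bigr => mm _.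
rewrite hornerM hornerC horner_prod; congr (_ * _).
by apply: eq_bigr => i _; rewrite horner_exp.
Qed.

Lemma deriv_mmap m (h : 'I_m -> {poly F}) p :
  (mmap (@polyC F) h p)^`() = \sum_i mmap (@polyC F) h p^`M(i) * (h i)^`().
Proof. by apply: (@mmap_chain_rule _ _ _ _ _ (@deriv F)); [exact: derivD|exact: derivM|exact: derivC]. Qed.

Lemma meval_at0 m (p : {mpoly F[m]}) : p.@[fun=> 0] = p@_0.
Proof.
elim/mpolyind: p => [|c mm p _ _ IH]; first by rewrite meval0 mcoeff0.
rewrite mevalD mcoeffD IH mevalZ mcoeffZ mcoeffX mevalX; congr (_ * _ + _).
have [->|] := eqVneq mm 0%MM; first by rewrite big1 // => i _; rewrite mnm0E.
rewrite -mdeg_eq0 mdegE sum_nat_eq0 negb_forall => /existsP[i /= mi].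
by rewrite (bigD1 i) //= expr0n (negPf mi) mul0r.
Qed.

Lemma mpoly_eval_eq0 m (p : {mpoly F[m]}) : (forall v, p.@[v] = 0) -> p = 0.
Proof.
move: p; apply: (mpoly_taylor_eq0 (Z := fun p => forall v, p.@[v] = 0)) => p.
  by move=> Zp; rewrite -meval_at0.
(* The restriction of [p] to the line through [v] in direction [i] has only zero values, hence is
   the zero polynomial; its derivative at 0 is the partial derivative at [v]. *)
move=> i Zp v; pose h j : {poly F} := (v j)%:P + (j == i)%:R *: 'X.
have h0 j : (h j).[0] = v j by rewrite /h hornerD hornerZ hornerC hornerX mulr0 addr0.
have: mmap (@polyC F) h p = 0 by apply: poly_eval_eq0 => c; rewrite horner_mmap.
move=> /(congr1 (fun q => q^`().[0])); rewrite deriv_mmap deriv0 horner0.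
rewrite (bigD1 i) //= big1 => [|j ji]; last first.
  by rewrite /h derivD derivC derivZ (negPf ji) scale0r addr0 mulr0.
rewrite addr0 /h derivD derivC derivZ eqxx derivX add0r scale1r mulr1 horner_mmap.
by move=> <-; apply: meval_eq => j; rewrite -[LHS]h0.
Qed.

End CharZero.

(** * Exponentials of nilpotent operators *)

Section Nilpotent.
Variables (F : fieldType) (M : vectType F) (T : {linear M -> M}).

Lemma iter_linear0 k : iter k T 0 = 0.
Proof. by elim: k => //= k ->; rewrite linear0. Qed.

Lemma iter_linear_sum k (I : Type) (r : seq I) (c : I -> F) (E : I -> M) :
  iter k T (\sum_(i <- r) c i *: E i) = \sum_(i <- r) c i *: iter k T (E i).
Proof.
elim: k => //= k ->; rewrite linear_sum; apply: eq_bigr => i _; exact: linearZ.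
Qed.

Lemma iter_free k u : iter k T u != 0 -> iter k.+1 T u = 0 -> free (traject T u k.+1).
Proof.
elim: k u => [|k IH] u Tu Tu0; first by rewrite trajectS /= seq1_free.
rewrite trajectS free_cons IH ?andbT -?iterSr //.
apply/negP => /(coord_span (X := in_tuple _)) uE; move: Tu.
rewrite uE (iter_linear_sum _ _ (fun i => coord _ i u)) big1 ?eqxx // => i _.
have ik : (i < k.+1)%N by have := ltn_ord i; rewrite [X in (_ < X)%N]size_traject.
have -> : (in_tuple (traject T (T u) k.+1))`_i = iter i T (T u) by rewrite (set_nth_default (T u)) ?nth_traject ?size_traject.
rewrite -iterSr -iterD addnS -addSn addnC iterD Tu0.
by rewrite iter_linear0 scaler0.
Qed.

Lemma nilpotent_dim K : (forall u, iter K T u = 0) ->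
  forall u k, (\dim {:M} <= k)%N -> iter k T u = 0.
Proof.
move=> TK u k dk; apply/eqP; apply: contraT => Tk.
have exk : exists k, iter k T u != 0 by exists k.
have ub j : iter j T u != 0 -> (j <= K)%N.
  apply: contraNT; rewrite -ltnNge => Kj.
  by rewrite -(subnK (ltnW Kj)) iterD TK iter_linear0.
case: (ex_maxnP exk ub) => m Tm maxm.
have Tm1 : iter m.+1 T u = 0.
  by apply/eqP; apply: contraT => /maxm; rewrite ltnn.
have fr := iter_free Tm Tm1.
have := dimvS (subvf <<traject T u m.+1>>%VS); rewrite (eqP fr) size_traject.
have := maxm k Tk; lia.
Qed.

(** Passes from the cut-off at the dimension built into [nilp_exp] to any cut-off beyond which the
    iterates vanish, such as the one in the generating functions. *)
Lemma nilp_expE K N u : (forall u, iter K T u = 0) -> (forall k, (N <= k)%N -> iter k T u = 0) ->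
  nilp_exp T u = \sum_(k < N) k`!%:R^-1 *: iter k T u.
Proof.
move=> TK TN; rewrite /nilp_exp.
have cut P Q : (forall k, (P <= k)%N -> iter k T u = 0) -> (P <= Q)%N ->
    \sum_(k < Q) k`!%:R^-1 *: iter k T u = \sum_(k < P) k`!%:R^-1 *: iter k T u.
  move=> TP PQ; rewrite -(big_mkord xpredT (fun k => k`!%:R^-1 *: iter k T u)).
  rewrite (big_cat_nat (leq0n P) PQ) //= big_mkord [X in _ + X = _]big_nat_cond [X in _ + X = _]big1 ?addr0 //.
  by move=> k /andP[/andP[/TP-> _] _]; rewrite scaler0.
have TD k : ((\dim {:M}).+1 <= k)%N -> iter k T u = 0 by move/ltnW; apply: nilpotent_dim TK _ _.
by case: (leqP N (\dim {:M}).+1) => [/(cut _ _ TN)|/ltnW/(cut _ _ TD)].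
Qed.

End Nilpotent.

Section Euler.
Variables (F : fieldType) (m : nat).
Implicit Types p : {mpoly F[m]}.

Lemma dhomog_mderiv d p i : p \is d.+1.-homog -> p^`M(i) \is d.-homog.
Proof.
move=> /dhomogP homp; apply/dhomogP => mm; rewrite mcoeff_msupp mcoeff_deriv => pm.
have : (mm + U_(i))%MM \in msupp p.
  by rewrite mcoeff_msupp; apply: contraNneq pm => ->; rewrite mul0rn.
by move=> /homp /= ; rewrite mdegD mdeg1 addn1 => -[].
Qed.

Lemma dhomog0_mderiv p i : p \is 0.-homog -> p^`M(i) = 0.
Proof.
move=> /dhomogP homp; apply/mpolyP => mm; rewrite mcoeff0 mcoeff_deriv.
rewrite memN_msupp_eq0 ?mul0rn //; apply/negP => /homp /=.
by rewrite mdegD mdeg1 addn1.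
Qed.

Lemma euler d p : p \is d.-homog -> \sum_i 'X_i * p^`M(i) = d%:R *: p.
Proof.
move=> /dhomogP homp; rewrite {2}[p]mpolyE scaler_sumr.
under eq_bigr => i _ do rewrite {1}[p]mpolyE linear_sum mulr_sumr.
rewrite exchange_big /= big_seq [RHS]big_seq; apply: eq_bigr => mm /homp dm.
transitivity (p@_mm *: \sum_i (mm i)%:R *: ('X_[mm] : {mpoly F[m]})); last first.
  by rewrite -scaler_suml -natr_sum -mdegE -dm !scalerA mulrC.
rewrite scaler_sumr; apply: eq_bigr => i _.
rewrite linearZ /= mderivX -scalerAr; congr (_ *: _).
case mi: (mm i) => [|k]; first by rewrite !scale0r mulr0.
rewrite -scalerAr -mpolyXD; congr (_ *: 'X_[_]).
by apply/mnmP => j; rewrite mnmDE mnmBE mnm1E; case: eqVneq => [<-|]; lia.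
Qed.

End Euler.

Section ConeStability.
Variables (F : fieldType) (n : nat) (M : vectType F).
Hypothesis F0 : [pchar F] =i pred0.
Local Notation D := (\dim {:M}).
Variables (w : 'I_D -> {mpoly F[n]}) (T : {linear M -> M}) (K : nat).
Hypothesis TK : forall u, iter K T u = 0.
Variables (b : 'I_n -> {mpoly F[n]}) (c : {mpoly F[n]}).

(** [T] acts on the parametrized cone as a vector field on the parameters plus a
    rescaling. *)
Hypothesis w_field : forall i,
  \sum_(j < D) xcoord i (T ((vbasis {:M})`_j)) *: w j = \sum_j b j * (w i)^`M(j) + c * w i.

Let lin (i : 'I_D) : {mpoly F[D]} := \sum_(j < D) xcoord i (T ((vbasis {:M})`_j)) *: 'X_j.

Let field_deriv (p : {mpoly F[D]}) : {mpoly F[D]} := \sum_i lin i * p^`M(i).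

Let lin_homog i : lin i \is 1.-homog.
Proof. by apply: rpred_sum => j _; apply: dhomogZ; apply: dhomogXU. Qed.

Let field_deriv_homog d p : p \is d.-homog -> field_deriv p \is d.-homog.
Proof.
case: d => [|d] homp; apply: rpred_sum => i _.
  by rewrite dhomog0_mderiv // mulr0 dhomog0.
by rewrite -add1n dhomogM // dhomog_mderiv.
Qed.

(** The vector field part of [w_field] differentiates [subst w p], by the chain rule. The rescaling
    part gives [c] times the degree times [subst w p], by Euler's formula, hence the homogeneity. *)
Let subst_field_deriv d p : p \is d.-homog -> subst w p = 0 -> subst w (field_deriv p) = 0.
Proof.
move=> homp wp; rewrite /field_deriv subst_sum.
have linE i : subst w (lin i) = \sum_j b j * (w i)^`M(j) + c * w i.
  by rewrite -w_field subst_sum; apply: eq_bigr => j _; rewrite substZ substX.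
under eq_bigr => i _ do rewrite substM linE mulrDl.
rewrite big_split /= [X in _ + X](_ : _ = 0) ?addr0; last first.
  transitivity (c * subst w (\sum_i 'X_i * p^`M(i))).
    rewrite subst_sum mulr_sumr; apply: eq_bigr => i _.
    by rewrite substM substX mulrA.
  by rewrite (euler homp) substZ wp scaler0 mulr0.
under eq_bigr do rewrite mulr_suml.
rewrite exchange_big /= big1 // => j _.
have := @mmap_chain_rule F _ _ (@mpolyC n F) w (mderiv j) (mderivD j) (mderivM j) (mderivC j) p.
rewrite -/(subst w p) wp linear0 => /esym chain0.
under eq_bigr do rewrite -mulrA; rewrite -mulr_sumr.
under eq_bigr do rewrite mulrC; by rewrite chain0 mulr0.
Qed.

(** The coordinate [i] of exp(t T) u as a polynomial in t. *)
Let orbit_poly u i : {poly F} := \poly_(k < K) (k`!%:R^-1 * xcoord i (iter k T u)).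

Let deriv_orbit_poly u i :
  (orbit_poly u i)^`() = mmap (@polyC F) (orbit_poly u) (lin i).
Proof.
rewrite /lin raddf_sum /=.
under eq_bigr => j _ do rewrite mmapZ mmapX mmap1U.
apply/polyP => k; rewrite coef_deriv coef_poly coef_sum.
under eq_bigr => j _ do rewrite coefCM coef_poly.
case: (ltnP k K) => kK; last first.
  rewrite ltnNge (leqW kK) /= mul0rn big1 // => j _; by rewrite mulr0.
have -> : (if (k.+1 < K)%N then k.+1`!%:R^-1 * xcoord i (iter k.+1 T u) else 0) =
    k.+1`!%:R^-1 * xcoord i (iter k.+1 T u).
  case: ltnP => // kK'; have -> : k.+1 = K by lia.
  by rewrite TK linear0 mulr0.
rewrite iterS {1}[iter k T u]xcoord_sum linear_sum linear_sum mulr_sumr -sumrMnl.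
apply: eq_bigr => j _; rewrite !linearZ /= factS natrM invfM -mulr_natr.
have := natrS_neq0 F0 k => k0; have := factr_neq0 F0 k => f0; by field; rewrite f0 nat1r.
Qed.

(** Let g(t) = p(exp(t T) u). Its derivatives at 0 are the values at [u] of the iterates of
    [field_deriv] on [p]; these are again homogeneous relations and vanish at [u]. In characteristic
    0 this gives g = 0, in particular g(1) = 0. *)
Lemma cone_nilp_exp u : in_cone w u -> in_cone w (nilp_exp T u).
Proof.
move=> cu d p homp wp; pose G := mmap (@polyC F) (orbit_poly u).
have G0 q : (G q).[0] = poly_eval q u.
  rewrite /G horner_mmap; apply: meval_eq => i.
  rewrite horner_coef0 coef_poly; case: ltnP => [_|]; first by rewrite invr1 mul1r.
  by rewrite leqn0 => /eqP K0; have := TK u; rewrite K0 /= => ->; rewrite linear0.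
have GD q : (G q)^`() = G (field_deriv q).
  rewrite /G deriv_mmap raddf_sum /=; apply: eq_bigr => i _.
  by rewrite deriv_orbit_poly rmorphM mulrC.
have Gp : G p = 0.
  apply: (poly_derivn_eq0 F0) => k.
  have -> : (G p)^`(k) = G (iter k field_deriv p).
    by elim: k => [|k IH] //; rewrite derivnS IH GD.
  rewrite G0; apply: (cu d); first by elim: k => //= k; apply: field_deriv_homog.
  suff : iter k field_deriv p \is d.-homog /\ subst w (iter k field_deriv p) = 0 by case.
  elim: k => //= k [homk wk]; split; first exact: field_deriv_homog.
  exact: subst_field_deriv homk wk.
have := congr1 (fun q => q.[1]) Gp; rewrite /= /G horner_mmap horner0 => <-.
apply: meval_eq => i; rewrite -[LHS]/(xcoord i _) (nilp_expE (N := K) TK).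
  rewrite linear_sum horner_poly; apply: eq_bigr => k _.
  by rewrite linearZ expr1n mulr1.
by move=> k Kk; rewrite -(subnK Kk) iterD TK iter_linear0.
Qed.

End ConeStability.

(** * The orbit of the lowest weight vector *)

Lemma scalar0 (F : fieldType) (M : vectType F) (xi : M -> F) : scalar xi -> xi 0 = 0.
Proof. by move=> xi_lin; have := xi_lin (-1) 0 0; rewrite scaler0 addr0 mulN1r addNr. Qed.

Lemma scalar_sum (F : fieldType) (M : vectType F) (xi : M -> F) (I : Type) (r : seq I)
    (c : I -> F) (E : I -> M) : scalar xi ->
  xi (\sum_(i <- r) c i *: E i) = \sum_(i <- r) c i * xi (E i).
Proof.
move=> xi_lin; elim: r => [|i r IH]; first by rewrite !big_nil scalar0.
by rewrite !big_cons xi_lin IH.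
Qed.

Section Words.
Variables (F : fieldType) (M : vectType F) (op : nat -> M -> M).
Hypothesis op_linear : forall k, linear (op k).

Definition word (t : seq nat) (u : M) : M := foldr op u t.

Lemma word_linear t : linear (word t).
Proof. by move=> a u v; elim: t => //= k t ->; apply: op_linear. Qed.

HB.instance Definition _ t := GRing.isLinear.Build F M M *:%R (word t) (word_linear t).

Variables (n : nat) (q : 'I_n -> F).

Definition comb (u : M) : M := \sum_k q k *: op k u.

Lemma comb_linear : linear comb.
Proof.
move=> a u v; rewrite /comb scaler_sumr -big_split; apply: eq_bigr => k _ /=.
by rewrite op_linear scalerDr !scalerA mulrC.
Qed.

Definition comb_lin : {linear M -> M} :=
  HB.pack comb (GRing.isLinear.Build F M M *:%R comb comb_linear).

Lemma iter_comb r u : (forall t, size t = r -> word t u = 0) -> iter r comb u = 0.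
Proof.
elim: r u => [|r IH] u tu; first exact: (tu [::]).
rewrite iterSr; apply: IH => t tr; rewrite linear_sum big1 // => k _.
rewrite linearZ /= -[word t _]/(word t (word [:: nat_of_ord k] u)) /word -foldr_cat.
by rewrite -/(word _ u) tu ?scaler0 // size_cat tr addn1.
Qed.

End Words.

Section LieModule.
Variables (F : fieldType) (n : nat) (M : vectType F).
Hypothesis F0 : [pchar F] =i pred0.
Variables (e f h : nat -> M -> M) (v : M) (lam : nat -> F) (K : nat).
Hypothesis e_linear : forall k, linear (e k).
Hypothesis f_linear : forall k, linear (f k).
Hypothesis h_linear : forall k, linear (h k).
Hypothesis eC : forall i j u, e i (e j u) = e j (e i u).
Hypothesis he : forall i j u, h i (e j u) = e j (h i u) + 2%:R *: e (i + j) u.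
Hypothesis fe : forall i j u, f i (e j u) = e j (f i u) - h (i + j) u.
Hypothesis fv : forall k, f k v = 0.
Hypothesis hv : forall k, h k v = lam k *: v.
Hypothesis e_trunc : forall k u, (n <= k)%N -> e k u = 0.
Hypothesis e_nilp : forall t u, size t = K -> word e t u = 0.
Hypothesis f_nilp : forall t u, size t = K -> word f t u = 0.
Local Notation S := {mpoly F[n]}.
Implicit Types (xi ze : M -> F).

(** [gen_deg r xi] is the polynomial [xi ((\sum_j 'X_j e_j)^r v)], and [gen xi]
    is [xi (exp (\sum_j 'X_j e_j) v)]. *)
Fixpoint gen_deg r xi : S :=
  if r is r'.+1 then \sum_(j < n) 'X_j * gen_deg r' (fun u => xi (e j u))
  else (xi v)%:MP.

Lemma gen_degS r xi :
  gen_deg r.+1 xi = \sum_(j < n) 'X_j * gen_deg r (fun u => xi (e j u)).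
Proof. by []. Qed.

Definition gen xi : S := \sum_(r < K) r`!%:R^-1 *: gen_deg r xi.

Lemma gen_degP r a xi ze :
  gen_deg r (fun u => a * xi u + ze u) = a *: gen_deg r xi + gen_deg r ze.
Proof.
elim: r xi ze => [|r IH] xi ze /=; first by rewrite mpolyCD mpolyCM mul_mpolyC.
rewrite scaler_sumr -big_split; apply: eq_bigr => j _ /=.
by rewrite IH mulrDr -scalerAr.
Qed.

Lemma genP a xi ze : gen (fun u => a * xi u + ze u) = a *: gen xi + gen ze.
Proof.
rewrite /gen scaler_sumr -big_split; apply: eq_bigr => r _ /=.
by rewrite gen_degP scalerDr !scalerA mulrC.
Qed.

Lemma gen0 : gen (fun=> 0) = 0.
Proof.
have := genP 1 (fun=> 0) (fun=> 0); rewrite mulr0 addr0 scale1r => /eqP.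
by rewrite addrC -subr_eq subrr => /eqP.
Qed.

Lemma genD xi ze : gen (fun u => xi u + ze u) = gen xi + gen ze.
Proof. by rewrite -[gen xi]scale1r -genP; congr gen; apply/funext => u; rewrite mul1r. Qed.

Lemma genZ a xi : gen (fun u => a * xi u) = a *: gen xi.
Proof. by rewrite -[RHS]addr0 -gen0 -genP; congr gen; apply/funext => u; rewrite addr0. Qed.

Lemma gen_sum (I : Type) (r : seq I) (E : I -> M -> F) :
  gen (fun u => \sum_(i <- r) E i u) = \sum_(i <- r) gen (E i).
Proof.
elim: r => [|i r IH].
  by rewrite big_nil -gen0; congr gen; apply/funext => u; rewrite big_nil.
by rewrite big_cons -IH -genD; congr gen; apply/funext => u; rewrite big_cons.
Qed.

Lemma mderiv_lincomb i (E : 'I_n -> S) :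
  (\sum_j 'X_j * E j)^`M(i) = E i + \sum_j 'X_j * (E j)^`M(i).
Proof.
rewrite linear_sum (bigD1 i) //= mderivM mderiv_var eqxx mul1r -addrA; congr (_ + _).
rewrite [RHS](bigD1 i) //=; congr (_ + _); apply: eq_bigr => j ji.
by rewrite mderivM mderiv_var (negPf ji) mul0r add0r.
Qed.

Lemma gen_deg_deriv r i xi :
  (gen_deg r.+1 xi)^`M(i) = r.+1%:R *: gen_deg r (fun u => xi (e i u)).
Proof.
elim: r xi => [|r IH] xi.
  rewrite [gen_deg _ _]/= mderiv_lincomb big1 ?addr0 ?scale1r // => j _.
  by rewrite mderivC mulr0.
rewrite gen_degS mderiv_lincomb.
have -> : \sum_(j < n) 'X_j * (gen_deg r.+1 (fun u => xi (e j u)))^`M(i) =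
    r.+1%:R *: gen_deg r.+1 (fun u => xi (e i u)).
  rewrite [in RHS]gen_degS scaler_sumr; apply: eq_bigr => j _.
  rewrite IH -scalerAr; congr (_ *: (_ * gen_deg _ _)).
  by apply/funext => u; rewrite eC.
by rewrite -[X in X + _]scale1r -scalerDl nat1r.
Qed.

Lemma gen_deg_vanish r xi : (forall t, size t = r -> xi (word e t v) = 0) -> gen_deg r xi = 0.
Proof.
elim: r xi => [|r IH] xi xit /=; first by rewrite (xit [::]).
rewrite big1 // => j _; rewrite IH ?mulr0 // => t tr.
by have := xit ((j : nat) :: t); rewrite /= tr; apply.
Qed.

(** As the [e k] commute, differentiating the exponential inserts one [e i]. The derivative has one
    term fewer than the right side; the extra term there involves words of length [K] and
    vanishes. *)
Lemma gen_deriv i xi : scalar xi -> (gen xi)^`M(i) = gen (fun u => xi (e i u)).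
Proof.
move=> xi_lin; rewrite /gen linear_sum; case: K e_nilp => [|k] e0.
  by rewrite !big_ord0.
rewrite big_ord_recl [RHS]big_ord_recr /= linearZ /= mderivC scaler0 add0r.
rewrite [X in _ = _ + _ *: X]gen_deg_vanish ?scaler0 ?addr0.
  apply: eq_bigr => r _; rewrite linearZ -[in LHS]/(bump 0 r) /bump /= add1n.
  rewrite -[\sum_(j < n) _]/(gen_deg r.+1 xi) gen_deg_deriv scalerA factS natrM invfM.
  by rewrite mulrAC mulVf ?mul1r // natrS_neq0.
move=> t tk; rewrite -[e i _]/(word e ((i : nat) :: t) v) e0 /= ?tk //.
exact: scalar0.
Qed.

Lemma gen_coef0 xi : (0 < K)%N -> (gen xi)@_0 = xi v.
Proof.
rewrite /gen; case: K => // k _; rewrite big_ord_recl mcoeffD mcoeffZ /= invr1 mul1r.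
rewrite mcoeffC eqxx mulr1 raddf_sum big1 ?addr0 // => r _.
rewrite /= mcoeffZ raddf_sum big1 ?mulr0 // => j _ /=.
by rewrite -!meval_at0 mevalM mevalXU mul0r.
Qed.

(** With x = sum_l X_l e_l, this is h_k exp(x) = exp(x) (h_k + 2 sum_l X_l e_(k+l)) applied to [v].
    The differences [D xi] vanish at the origin, and a partial derivative replaces [xi] by its
    composite with [e i], so the Taylor criterion applies. *)
Lemma gen_h k xi : scalar xi -> (0 < K)%N -> gen (fun u => xi (h k u)) =
  lam k *: gen xi + 2%:R *: \sum_(l < n) 'X_l * gen (fun u => xi (e (k + l) u)).
Proof.
move=> xi_lin K0; apply/eqP; rewrite -subr_eq0; apply/eqP.
pose D xi := gen (fun u => xi (h k u)) - (lam k *: gen xi +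
  2%:R *: \sum_(l < n) 'X_l * gen (fun u => xi (e (k + l) u))).
rewrite -/(D xi).
apply: (mpoly_taylor_eq0 F0 (Z := fun p => exists2 xi, scalar xi & p = D xi)); last by exists xi.
  move=> _ [{xi_lin}xi xi_lin ->]; rewrite mcoeffB gen_coef0 // mcoeffD !mcoeffZ.
  rewrite gen_coef0 // raddf_sum big1 ?mulr0 ?addr0 => [|l _]; last first.
    by rewrite /= -meval_at0 mevalM mevalXU mul0r.
  have xi0 := scalar0 xi_lin.
  by rewrite hv -[_ *: v]addr0 xi_lin xi0 addr0 subrr.
move=> _ i [{xi_lin}xi xi_lin ->]; exists (fun u => xi (e i u)).
  by move=> a u u'; rewrite e_linear xi_lin.
have comp_lin (g : nat -> M -> M) : (forall k, linear (g k)) -> forall j, scalar (fun u => xi (g j u)).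
  by move=> gl j a u u'; rewrite gl xi_lin.
rewrite /D mderivB mderivD !mderivZ mderiv_lincomb.
rewrite !(gen_deriv _ xi_lin) (gen_deriv _ (comp_lin _ h_linear _)).
have -> : (fun u => xi (h k (e i u))) =
    fun u => xi (e i (h k u)) + 2%:R * xi (e (k + i) u).
  by apply/funext => u; rewrite he [X in xi X]addrC xi_lin addrC.
under eq_bigr => l _ do rewrite (gen_deriv _ (comp_lin _ e_linear _)).
have -> : \sum_(l < n) 'X_l * gen (fun u => xi (e (k + l) (e i u))) =
    \sum_(l < n) 'X_l * gen (fun u => xi (e i (e (k + l) u))).
  by apply: eq_bigr => l _; congr (_ * gen _); apply/funext => u; rewrite eC.
rewrite genD genZ -!mul_mpolyC; ring.
Qed.

(** Here f_k exp(x) = exp(x) (f_k - sum_j X_j h_(k+j) - sum_(j,l) X_j X_l e_(k+j+l)), the 1/2 of the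
    second commutator cancelling the 2 in [h, e]. The Taylor criterion applies again, with [gen_h]
    for the bracket [f, e]. *)
Lemma gen_f k xi : scalar xi -> (0 < K)%N -> gen (fun u => xi (f k u)) =
  - \sum_(j < n) 'X_j * (lam (k + j) *: gen xi) -
  \sum_(j < n) 'X_j * \sum_(l < n) 'X_l * gen (fun u => xi (e (k + j + l) u)).
Proof.
move=> xi_lin K0; apply/eqP; rewrite -subr_eq0; apply/eqP.
pose D xi := gen (fun u => xi (f k u)) -
  (- \sum_(j < n) 'X_j * (lam (k + j) *: gen xi) -
  \sum_(j < n) 'X_j * \sum_(l < n) 'X_l * gen (fun u => xi (e (k + j + l) u))).
rewrite -/(D xi).
apply: (mpoly_taylor_eq0 F0 (Z := fun p => exists2 xi, scalar xi & p = D xi)); last by exists xi.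
  move=> _ [{xi_lin}xi xi_lin ->]; rewrite mcoeffB gen_coef0 // mcoeffB mcoeffN.
  have X0 (E : 'I_n -> S) : (\sum_j 'X_j * E j)@_0 = 0.
    by rewrite raddf_sum big1 // => j _; rewrite /= -meval_at0 mevalM mevalXU mul0r.
  have xi0 := scalar0 xi_lin.
  by rewrite !X0 fv xi0 !(subr0, oppr0).
move=> _ i [{xi_lin}xi xi_lin ->]; exists (fun u => xi (e i u)).
  by move=> a u u'; rewrite e_linear xi_lin.
have comp_lin (g : nat -> M -> M) : (forall k, linear (g k)) -> forall j, scalar (fun u => xi (g j u)).
  by move=> gl j a u u'; rewrite gl xi_lin.
rewrite /D !mderivB mderivN !mderiv_lincomb.
under eq_bigr => j _ do rewrite mderivZ (gen_deriv _ xi_lin).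
rewrite (gen_deriv _ (comp_lin _ f_linear _)).
have -> : (fun u => xi (f k (e i u))) =
    fun u => xi (e i (f k u)) + (-1) * xi (h (k + i) u).
  by apply/funext => u; rewrite fe -scaleN1r [X in xi X]addrC xi_lin addrC.
rewrite genD genZ gen_h //.
have -> : \sum_(j < n) 'X_j *
      (\sum_(l < n) 'X_l * gen (fun u => xi (e (k + j + l) u)))^`M(i) =
    \sum_(l < n) 'X_l * gen (fun u => xi (e (k + i + l) u)) +
    \sum_(j < n) 'X_j * \sum_(l < n) 'X_l * gen (fun u => xi (e i (e (k + j + l) u))).
  rewrite -big_split; apply: eq_bigr => j _ /=; rewrite -mulrDr; congr (_ * _).
  rewrite mderiv_lincomb; congr (gen _ + _); first by rewrite addnAC.
  apply: eq_bigr => l _; rewrite (gen_deriv _ (comp_lin _ e_linear _)).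
  by congr (_ * gen _); apply/funext => u; rewrite eC.
rewrite -!mul_mpolyC mpolyCN mpolyC1; ring.
Qed.

Lemma gen_deg_eval r xi q : scalar xi -> (gen_deg r xi).@[q] = xi (iter r (comb e q) v).
Proof.
elim: r xi => [|r IH] xi xi_lin; first by rewrite /= mevalC.
rewrite gen_degS raddf_sum iterS [comb e q _]/comb (scalar_sum _ _ _ xi_lin).
apply: eq_bigr => j _; rewrite /= mevalM mevalXU IH // => a u u'.
by rewrite e_linear xi_lin.
Qed.

Let comb_nilp (op : nat -> M -> M) (q : 'I_n -> F) :
  (forall k, linear (op k)) -> (forall t u, size t = K -> word op t u = 0) ->
  forall u, iter K (comb op q) u = 0.
Proof. by move=> lin nilp u; apply: iter_comb => // t; apply: nilp. Qed.

Lemma gen_eval xi q : scalar xi -> (gen xi).@[q] = xi (nilp_exp (comb e q) v).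
Proof.
move=> xi_lin; have nil := comb_nilp q e_linear e_nilp.
rewrite -[comb e q]/(comb_lin e_linear q : M -> M) (@nilp_expE _ _ _ K K) //; last first.
  by move=> k Kk; rewrite -(subnK Kk) iterD nil iter_linear0.
rewrite (scalar_sum _ _ _ xi_lin) raddf_sum; apply: eq_bigr => r _.
by rewrite /= mevalZ gen_deg_eval.
Qed.

Local Notation w := (fun i => gen (@xcoord F M i)).

Lemma gen_coords xi : scalar xi -> gen xi = \sum_(j < \dim {:M}) xi (vbasis {:M})`_j *: w j.
Proof.
move=> xi_lin; under eq_bigr do rewrite -genZ; rewrite -gen_sum; congr gen.
apply/funext => u; rewrite {1}[u]xcoord_sum (scalar_sum _ _ _ xi_lin).
by apply: eq_bigr => j _; rewrite mulrC.
Qed.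

Lemma gen_e m xi : scalar xi ->
  gen (fun u => xi (e m u)) = \sum_(i < n) (m == i)%:R *: (gen xi)^`M(i).
Proof.
move=> xi_lin; have [nm|mn] := leqP n m.
  rewrite big1 => [|i _]; last by rewrite gtn_eqF ?scale0r // (leq_trans (ltn_ord i)).
  by rewrite -gen0; congr gen; apply/funext => u; rewrite e_trunc // scalar0.
rewrite (bigD1 (Ordinal mn)) //= eqxx scale1r gen_deriv // big1 ?addr0 // => i im.
by rewrite eq_sym (negPf (_ : i != m :> nat)) ?scale0r.
Qed.

Let gen_comb (op : nat -> M -> M) (op_linear : forall k, linear (op k)) (q : 'I_n -> F) i :
  \sum_(j < \dim {:M}) xcoord i (comb_lin op_linear q (vbasis {:M})`_j) *: w j =
  \sum_k q k *: gen (fun x => xcoord i (op k x)).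
Proof.
rewrite -(gen_coords (xi := fun u => xcoord i (comb_lin op_linear q u))); last first.
  by move=> a x y; rewrite !linearP.
under [RHS]eq_bigr do rewrite -genZ; rewrite -gen_sum; congr gen; apply/funext => x.
by rewrite linear_sum; apply: eq_bigr => j _; rewrite linearZ.
Qed.

Lemma cone_exp_e (q : 'I_n -> F) u : in_cone w u -> in_cone w (nilp_exp (comb e q) u).
Proof.
apply: (@cone_nilp_exp _ _ _ F0 _ (comb_lin e_linear q) K _ (fun j => (q j)%:MP) 0).
  exact: comb_nilp.
move=> i; rewrite mul0r addr0 gen_comb //; apply: eq_bigr => j _; rewrite mul_mpolyC gen_deriv //.
by move=> a x y; rewrite linearP.
Qed.

Lemma cone_exp_f (q : 'I_n -> F) u : (0 < K)%N -> in_cone w u -> in_cone w (nilp_exp (comb f q) u).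
Proof.
move=> K0.
(* Both are read off from [gen_f], where [gen_e] turns [e (k + j + l)] into the partial derivative
   of that index, or into 0 from index [n] on. *)
pose b (i : 'I_n) : S := - \sum_(k < n) \sum_(j < n) \sum_(l < n)
  ((k + j + l)%N == i)%:R *: (q k *: ('X_j * 'X_l)).
pose c : S := - \sum_(k < n) \sum_(j < n) (q k * lam (k + j)) *: 'X_j.
apply: (@cone_nilp_exp _ _ _ F0 _ (comb_lin f_linear q) K _ b c).
  exact: comb_nilp.
move=> i; have xi_lin : scalar (@xcoord F M i) by move=> a x y; rewrite linearP.
rewrite gen_comb // /b /c.
transitivity (- \sum_(k < n) \sum_(j < n) \sum_(l < n)
    (q k *: ('X_j * 'X_l)) * gen (fun u => xcoord i (e (k + j + l) u)) -
  \sum_(k < n) \sum_(j < n) (q k * lam (k + j)) *: 'X_j * w i).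
  rewrite -!sumrN -big_split; apply: eq_bigr => k _ /=.
  rewrite gen_f // scalerBr addrC; congr (_ + _).
    rewrite scalerN scaler_sumr; congr (- _); apply: eq_bigr => j _.
    by rewrite -scalerAr scalerA scalerAl.
  rewrite scaler_sumr; congr (- _); apply: eq_bigr => j _.
  by rewrite mulr_sumr scaler_sumr; apply: eq_bigr => l _; rewrite -scalerAl mulrA.
congr (_ + _); last by rewrite mulNr mulr_suml; congr (- _); apply: eq_bigr => k _; rewrite mulr_suml.
under [RHS]eq_bigr => j _ do rewrite mulNr.
rewrite sumrN; congr (- _).
under [RHS]eq_bigr => i' _ do rewrite mulr_suml.
rewrite [RHS]exchange_big; apply: eq_bigr => k _ /=.
under [RHS]eq_bigr => i' _ do rewrite mulr_suml.
rewrite [RHS]exchange_big; apply: eq_bigr => j _ /=.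
under [RHS]eq_bigr => i' _ do rewrite mulr_suml.
rewrite [RHS]exchange_big; apply: eq_bigr => l _ /=.
rewrite gen_e // mulr_sumr; apply: eq_bigr => i' _.
by rewrite -scalerAr -[RHS]scalerAl.
Qed.

Variable act : 'M[F]_2 -> nat -> M -> M.
Hypothesis actE : act (delta_mx 0 1) = e.
Hypothesis actF : act (delta_mx 1 0) = f.
Variable xi0 : M -> F.
Hypothesis xi0_lin : scalar xi0.
Hypothesis gen_xi0 : gen xi0 = 1.
Hypothesis K_gt0 : (0 < K)%N.
Hypothesis n_gt0 : (0 < n)%N.

Lemma det_elem (p : {poly %/ 'X^n : {poly F}}) : \det (elem_e p) = 1 /\ \det (elem_f p) = 1.
Proof. by split; rewrite det_mx22 !mxE /= ?mulr0n ?mulr1n; ring. Qed.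

(** From left to right: [v] is the value of the parametrization at 0 and the cone is stable under
    the group, so the relations vanish on the orbit. From right to left: a form vanishing on the
    orbit vanishes at every exp(sum_k q_k e_k) v, so its substitution has only zero values and is
    zero. *)
Lemma closure_orbitP L :
  zariski_closure (SL2_orbit n act v) L <-> in_closure w L.
Proof.
have cone_acts g T : @SL2_acts F n M act g T -> forall u, in_cone w u -> in_cone w (T u).
  elim=> [p|p|g1 g2 T1 T2 _ IH1 _ IH2] u cu; last by apply/IH1/IH2.
    have := @cone_exp_e (fun k => (val p)`_k) u cu.
    by rewrite /trunc_act actE.
  have := @cone_exp_f (fun k => (val p)`_k) u K_gt0 cu.
  by rewrite /trunc_act actF.
have xc_lin i : scalar (@xcoord F M i) by move=> a x y; rewrite linearP.
have cone_v : in_cone w v.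
  move=> d p _ /(congr1 (fun q => q.@[fun=> 0])); rewrite subst_meval meval0 => <-.
  by apply: meval_eq => i; rewrite meval_at0 gen_coef0.
split=> [clL|cL d p homp orb0].
  suff clL' d p : p \is d.-homog -> subst w p = 0 -> vanishes p L.
    by move=> u uL d p homp wp; apply: (clL' d p).
  move=> homp wp; apply: (clL d) => // L' [g [T [_ gT L'E]]].
  by apply/(vanishes_line homp L'E)/(cone_acts _ _ gT v cone_v d).
suff wp : subst w p = 0 by move=> u uL; apply: (cL u uL d).
apply: mpoly_eval_eq0 => // q; rewrite subst_meval.
(* The functional [xi0] takes the value 1 at this vector whatever [q] is, so the vector spans a
   point of the orbit. *)
have [u u0 uE] : exists2 u, u != 0 & u = nilp_exp (comb e q) v.
  eexists; last reflexivity; apply: contra_eq_neq (gen_eval q xi0_lin) => ->.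
  by rewrite gen_xi0 meval1 scalar0 // oner_neq0.
have [L' L'E] := line_proj u0.
pose qs : {poly F} := \poly_(k < n) (if insub k is Some i then q i else 0).
pose qq : {poly %/ 'X^n : {poly F}} := in_qpoly 'X^n qs.
have qqE : val qq = qs.
  by apply: in_qpoly_small; rewrite mk_monic_Xn ?size_polyXn ltnS prednK // size_poly.
have TE : trunc_act act (delta_mx 0 1) qq = comb e q.
  apply/funext => x; rewrite /trunc_act actE qqE; apply: eq_bigr => k _; congr (_ *: _).
  by rewrite coef_poly ltn_ord valK.
have /orb0/(vanishes_line homp L'E) : SL2_orbit n act v L'.
  exists (elem_e qq), (nilp_exp (trunc_act act (delta_mx 0 1) qq)); split.
  - exact: (det_elem qq).1.
  - exact: SL2_acts_e.
  - by rewrite L'E uE TE.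
by move=> <-; apply: meval_eq => i; rewrite gen_eval // uE.
Qed.

End LieModule.

(** * The tensor product of evaluation modules *)

Section Sl2.
Variable F : fieldType.

Definition sl2e : 'M[F]_2 := delta_mx 0 1.
Definition sl2f : 'M[F]_2 := delta_mx 1 0.
Definition sl2h : 'M[F]_2 := delta_mx 0 0 - delta_mx 1 1.

Lemma mxtrace22 (x : 'M[F]_2) : \tr x = x 0 0 + x 1 1.
Proof.
rewrite /mxtrace !big_ord_recl big_ord0 addr0.
by congr (_ + x _ _); apply/val_inj.
Qed.

Lemma sl2_trace : [/\ \tr sl2e == 0, \tr sl2f == 0 & \tr sl2h == 0].
Proof.
by split; rewrite mxtrace22 !mxE /= ?mulr1n ?mulr0n ?subr0 ?sub0r ?addr0 ?subrr.
Qed.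

Lemma sl2_decomp (x : 'M[F]_2) : \tr x == 0 ->
  x = x 0 1 *: sl2e + x 1 0 *: sl2f + x 0 0 *: sl2h.
Proof.
rewrite mxtrace22 addrC addr_eq0 => /eqP x11.
by apply: matrix22P; rewrite !mxE /= ?mulr1n ?mulr0n ?x11; ring.
Qed.

Variable a : nat.
Local Notation rep x := (sl2_rep a x).

Lemma sl2_repP c x y : rep (c *: x + y) = c *: rep x + rep y :> 'M[F]_a.
Proof. by apply/matrixP => i j; rewrite !mxE; ring. Qed.

Lemma rep_eE i j : rep sl2e i j = (a.-1 - j)%:R * (i == j.+1 :> nat)%:R.
Proof. by rewrite !mxE /= ?mulr1n ?mulr0n; ring. Qed.

Lemma rep_fE i j : rep sl2f i j = j%:R * (i.+1 == j :> nat)%:R.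
Proof. by rewrite !mxE /= ?mulr1n ?mulr0n; ring. Qed.

Lemma rep_hE i j : rep sl2h i j = (j%:R - (a.-1 - j)%:R) * (i == j :> nat)%:R.
Proof. by rewrite !mxE /= ?mulr1n ?mulr0n; ring. Qed.

Lemma rep_ef : rep sl2e *m rep sl2f = rep sl2f *m rep sl2e + 1 *: rep sl2h.
Proof.
apply/matrixP => i j; rewrite [LHS]mxE [RHS]mxE.
rewrite [X in _ = X + _]mxE [X in _ = _ + X]mxE mul1r rep_hE.
have [ai aj] := (ltn_ord i, ltn_ord j).
have -> : \sum_k rep sl2e i k * rep sl2f k j = (j * (a - j))%:R * (i == j :> nat)%:R.
  case j0 : (j : nat) => [|j'].
    by rewrite mul0n mul0r big1 // => k _; rewrite rep_fE j0 mul0r mulr0.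
  have j'a : (j' < a)%N by lia.
  rewrite (bigD1 (Ordinal j'a)) //= big1 => [|k kj]; last first.
    rewrite rep_fE j0 eqSS (negPf (_ : k != j' :> nat)) ?mulr0 //.
  rewrite addr0 rep_eE rep_fE /= j0 eqxx mulr1.
  have -> : (a - j'.+1 = a.-1 - j')%N by lia.
  by rewrite mulnC natrM mulrAC.
have -> : \sum_k rep sl2f i k * rep sl2e k j = (j.+1 * (a.-1 - j))%:R * (i == j :> nat)%:R.
  have [ja|ja] := ltnP j.+1 a; last first.
    have -> : (a.-1 - j = 0)%N by lia.
    rewrite muln0 mul0r big1 // => k _; rewrite rep_eE.
    have -> : (a.-1 - j = 0)%N by lia.
    by rewrite mul0r mulr0.
  rewrite (bigD1 (Ordinal ja)) //= big1 => [|k kj]; last first.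
    rewrite rep_eE (negPf (_ : k != j.+1 :> nat)) ?mulr0 //.
  by rewrite addr0 rep_eE rep_fE /= eqxx mulr1 eqSS natrM; ring.
rewrite -mulrDl; congr (_ * _); rewrite !natrM -[in RHS]natr1.
have -> : (a - j = (a.-1 - j).+1)%N by lia.
by rewrite -natr1; ring.
Qed.

Lemma rep_he : rep sl2h *m rep sl2e = rep sl2e *m rep sl2h + 2%:R *: rep sl2e.
Proof.
apply/matrixP => i j; rewrite [LHS]mxE [RHS]mxE.
rewrite [X in _ = X + _]mxE [X in _ = _ + X]mxE.
rewrite (bigD1 i) //= big1 => [|k ki]; last first.
  by rewrite rep_hE eq_sym (negPf (_ : k != i :> nat)) ?mulr0 ?mul0r.
rewrite (bigD1 j) //= big1 => [|k kj]; last first.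
  by rewrite rep_hE (negPf (_ : k != j :> nat)) ?mulr0.
rewrite !addr0 !rep_hE !eqxx !mulr1 rep_eE.
have [ij|_] := eqVneq (i : nat) j.+1; last by rewrite !mulr0 !mul0r addr0.
have [ai aj] := (ltn_ord i, ltn_ord j).
rewrite ij !mulr1; have -> : (a.-1 - j = (a.-1 - j.+1).+1)%N by lia.
by rewrite -!natr1; ring.
Qed.

End Sl2.

Section Tensor.
Variables (F : fieldType) (n : nat) (a : 'I_n -> nat) (z : 'I_n -> F).
Local Notation V := (tensor F a).
Implicit Types (u : V) (s : multi_index a) (x y w : 'M[F]_2).

Lemma tensorP c u u' s : (c *: u + u') s = c * u s + u' s.
Proof. by rewrite !ffunE. Qed.

Lemma tensorZ c u s : (c *: u) s = c * u s.
Proof. by rewrite ffunE. Qed.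

Lemma tensor_sum (I : Type) (r : seq I) (E : I -> V) s :
  (\sum_(i <- r) E i) s = \sum_(i <- r) E i s.
Proof. by elim/big_rec2: _ => [|i x u _ <-]; rewrite ffunE. Qed.

Lemma subst_index_in s i (j : 'I_(a i)) : subst_index s j i = j.
Proof. by rewrite ffunE dfwith_in. Qed.

Lemma subst_index_out s i (j : 'I_(a i)) k : i != k -> subst_index s j k = s k.
Proof. by move=> ik; rewrite ffunE dfwith_out. Qed.

Lemma subst_index_twice s i (j l : 'I_(a i)) : subst_index (subst_index s j) l = subst_index s l.
Proof.
apply/ffunP => k; have [<-|ik] := eqVneq i k; first by rewrite !subst_index_in.
by rewrite !subst_index_out.
Qed.

Lemma subst_indexC s i k (j : 'I_(a i)) (l : 'I_(a k)) : i != k ->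
  subst_index (subst_index s j) l = subst_index (subst_index s l) j.
Proof.
move=> ik; apply/ffunP => m.
have [<-|im] := eqVneq i m.
  by rewrite subst_index_in subst_index_out ?subst_index_in // eq_sym.
have [<-|km] := eqVneq k m; first by rewrite subst_index_in subst_index_out ?subst_index_in.
by rewrite !subst_index_out.
Qed.

Lemma subst_index_id s i : subst_index s (s i) = s.
Proof.
apply/ffunP => m; have [<-|im] := eqVneq i m; first by rewrite subst_index_in.
by rewrite subst_index_out.
Qed.

Definition factor_mx i (A : 'M[F]_(a i)) u : V :=
  [ffun s : multi_index a => \sum_(j < a i) A (s i) j * u (subst_index s j)].

Lemma factor_mxM i (A B : 'M[F]_(a i)) u : factor_mx A (factor_mx B u) = factor_mx (A *m B) u.
Proof.
apply/ffunP => s; rewrite !ffunE.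
under eq_bigr => j _ do rewrite ffunE mulr_sumr.
rewrite exchange_big; apply: eq_bigr => l _ /=.
rewrite mxE mulr_suml; apply: eq_bigr => j _.
by rewrite subst_index_in subst_index_twice mulrA.
Qed.

Lemma factor_mxC i k (A : 'M[F]_(a i)) (B : 'M[F]_(a k)) u : i != k ->
  factor_mx A (factor_mx B u) = factor_mx B (factor_mx A u).
Proof.
move=> ik; apply/ffunP => s; rewrite !ffunE.
under eq_bigr => j _ do rewrite ffunE mulr_sumr.
rewrite exchange_big; apply: eq_bigr => l _ /=.
rewrite ffunE mulr_sumr; apply: eq_bigr => j _.
by rewrite !subst_index_out ?[k == i]eq_sym // (subst_indexC _ _ _ ik) mulrCA.
Qed.

Lemma factor_mxP i (A : 'M[F]_(a i)) c u u' :
  factor_mx A (c *: u + u') = c *: factor_mx A u + factor_mx A u'.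
Proof.
apply/ffunP => s; rewrite tensorP !ffunE mulr_sumr -big_split.
by apply: eq_bigr => j _; rewrite tensorP /=; ring.
Qed.

Lemma factor_mx_linear i c (A B : 'M[F]_(a i)) u :
  factor_mx (c *: A + B) u = c *: factor_mx A u + factor_mx B u.
Proof.
apply/ffunP => s; rewrite tensorP !ffunE mulr_sumr -big_split.
by apply: eq_bigr => j _; rewrite !mxE /=; ring.
Qed.

Lemma factor_mx_linear_r i c (A B : 'M[F]_(a i)) u :
  factor_mx (A + c *: B) u = factor_mx A u + c *: factor_mx B u.
Proof. by rewrite addrC factor_mx_linear addrC. Qed.

Lemma factor_actE i x u : factor_act i x u = factor_mx (sl2_rep (a i) x) u.
Proof. by []. Qed.

Lemma eval_act_linear x k : linear (@eval_act F n a z x k).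
Proof.
move=> c u u'; rewrite /eval_act scaler_sumr -big_split; apply: eq_bigr => i _ /=.
by rewrite !factor_actE factor_mxP scalerDr !scalerA mulrC.
Qed.

Lemma eval_actP c x y k u :
  eval_act z (c *: x + y) k u = c *: eval_act z x k u + eval_act z y k u.
Proof.
rewrite /eval_act scaler_sumr -big_split; apply: eq_bigr => i _ /=.
by rewrite !factor_actE sl2_repP factor_mx_linear scalerDr !scalerA mulrC.
Qed.

Lemma eval_actE x k u s : eval_act z x k u s =
  \sum_i z i ^+ k * \sum_(j < a i) sl2_rep (a i) x (s i) j * u (subst_index s j).
Proof. by rewrite tensor_sum; apply: eq_bigr => i _; rewrite tensorZ ffunE. Qed.

(** Distinct tensor factors commute; the bracket comes from the diagonal terms of the double sum,
    where the scalars combine to z_i^(k+l). *)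
Lemma eval_act_comm c x y w :
    (forall m, sl2_rep m x *m sl2_rep m y = sl2_rep m y *m sl2_rep m x + c *: sl2_rep m w) ->
  forall k l u, eval_act z x k (eval_act z y l u) =
    eval_act z y l (eval_act z x k u) + c *: eval_act z w (k + l) u.
Proof.
move=> xy k l u.
have dbl x1 k1 y1 l1 : eval_act z x1 k1 (eval_act z y1 l1 u) =
    \sum_i \sum_j (z i ^+ k1 * z j ^+ l1) *:
      factor_mx (sl2_rep (a i) x1) (factor_mx (sl2_rep (a j) y1) u).
  apply/ffunP => s; rewrite eval_actE tensor_sum; apply: eq_bigr => i _.
  rewrite tensor_sum mulr_sumr.
  under eq_bigr => m _ do rewrite eval_actE mulr_sumr mulr_sumr.
  rewrite exchange_big; apply: eq_bigr => j _; rewrite tensorZ ffunE mulr_sumr.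
  by apply: eq_bigr => m _; rewrite [factor_mx _ _ _]ffunE; ring.
rewrite !dbl [in RHS]exchange_big /= /eval_act scaler_sumr -big_split.
apply: eq_bigr => i _ /=; rewrite (bigD1 i) //= [in RHS](bigD1 i) //=.
rewrite !factor_mxM xy factor_mx_linear_r scalerDr -!addrA; congr (_ + _).
  by rewrite mulrC.
rewrite addrC; congr (_ + _); last by rewrite !scalerA exprD mulrC.
by apply: eq_bigr => j ji; rewrite factor_mxC 1?eq_sym // mulrC.
Qed.

End Tensor.

Lemma vandermonde_unit (F : fieldType) m (y : 'I_m -> F) :
  injective y -> Vandermonde m (\row_i y i) \in unitmx.
Proof.
move=> y_inj; rewrite unitmxE det_Vandermonde unitfE.
apply/prodf_neq0 => i _; apply/prodf_neq0 => j ij; rewrite !mxE subr_eq0.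
by apply: contraTneq ij => /y_inj->; rewrite ltnn.
Qed.

Lemma interpolation (F : fieldType) m (y : 'I_m -> F) (b : 'I_m -> F) :
  injective y -> exists c : 'I_m -> F, forall i, b i = \sum_l c l * y i ^+ l.
Proof.
move=> /vandermonde_unit Vu; set V := Vandermonde _ _ in Vu.
exists (fun l => (\row_i b i *m invmx V) 0 l) => i.
have : (\row_i b i *m invmx V *m V) 0 i = b i by rewrite mulmxKV // mxE.
by move=> <-; rewrite mxE; apply: eq_bigr => l _; congr (_ * _); rewrite /V !mxE.
Qed.

Section LowestVector.
Variables (F : fieldType) (n : nat) (a : 'I_n -> nat) (z : 'I_n -> F).
Local Notation V := (tensor F a).
Local Notation ev := (@eval_act F n a z).
Local Notation v := (lowest_vector F a).
Implicit Types (u : V) (s : multi_index a) (t : seq nat).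

Lemma ev_ee k l u : ev (sl2e F) k (ev (sl2e F) l u) = ev (sl2e F) l (ev (sl2e F) k u).
Proof.
rewrite (@eval_act_comm F n a z 0 _ _ 0) ?scale0r ?addr0 // => m.
by rewrite scale0r addr0.
Qed.

Lemma ev_he k l u : ev (sl2h F) k (ev (sl2e F) l u) =
  ev (sl2e F) l (ev (sl2h F) k u) + 2%:R *: ev (sl2e F) (k + l) u.
Proof. by apply: eval_act_comm => m; apply: rep_he. Qed.

Lemma ev_fe k l u : ev (sl2f F) k (ev (sl2e F) l u) =
  ev (sl2e F) l (ev (sl2f F) k u) + -1 *: ev (sl2h F) (k + l) u.
Proof.
apply: eval_act_comm => m; rewrite rep_ef -addrA -scalerDl subrr.
by rewrite scale0r addr0.
Qed.

Lemma ev_f_lowest k : ev (sl2f F) k v = 0.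
Proof.
apply/ffunP => s; rewrite eval_actE ffunE big1 // => i _; rewrite big1 ?mulr0 // => j _.
rewrite rep_fE ffunE; case: forallP => [/(_ i)|]; last by rewrite mulr0.
by rewrite subst_index_in => /eqP ->; rewrite !mul0r.
Qed.

Definition lowest_weight k : F := - \sum_i z i ^+ k * (a i).-1%:R.

Lemma ev_h_lowest k : ev (sl2h F) k v = lowest_weight k *: v.
Proof.
apply/ffunP => s; rewrite eval_actE tensorZ /lowest_weight mulNr mulr_suml -sumrN.
apply: eq_bigr => i _; rewrite (bigD1 (s i)) //= big1 ?addr0 => [|j js]; last first.
  by rewrite rep_hE (negPf (_ : s i != j :> nat)) ?mulr0 ?mul0r // eq_sym.
rewrite rep_hE eqxx mulr1 subst_index_id ffunE.
case: forallP => [/(_ i)/eqP ->|_]; last by rewrite !mulr0 oppr0.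
by rewrite subn0; ring.
Qed.

Definition height s := (\sum_i s i)%N.

Lemma height_subst s i (j : 'I_(a i)) : (height (subst_index s j) + s i = height s + j)%N.
Proof.
have E : (\sum_(k | k != i) subst_index s j k = \sum_(k | k != i) s k)%N.
  by apply: eq_bigr => k ki; rewrite subst_index_out 1?eq_sym.
by rewrite /height (bigD1 i) //= E [in RHS](bigD1 i) //= subst_index_in; lia.
Qed.

(** Exceeds every [height]; [e] raises and [f] lowers the height by one, so words of this length act
    by zero. *)
Definition nilp_len := (\sum_i a i).+1.

Lemma height_lt s : (height s < nilp_len)%N.
Proof. by rewrite ltnS leq_sum // => i _; apply/ltnW/ltn_ord. Qed.

Lemma ev_e_nilp t u : size t = nilp_len -> word (ev (sl2e F)) t u = 0.
Proof.
move=> tK; apply/ffunP => s; rewrite ffunE.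
have : (height s < size t)%N by rewrite tK height_lt.
elim: t s {tK} => //= k t IH s st; rewrite eval_actE big1 // => i _.
rewrite big1 ?mulr0 // => j _; rewrite rep_eE.
have [sj|] := eqVneq (s i : nat) j.+1; last by rewrite mulr0 mul0r.
by rewrite IH ?mulr0 //; have := height_subst s j; lia.
Qed.

Lemma ev_f_nilp t u : size t = nilp_len -> word (ev (sl2f F)) t u = 0.
Proof.
move=> tK; apply/ffunP => s; rewrite ffunE.
have : (nilp_len <= height s + size t)%N by rewrite tK leq_addl.
elim: t s {tK} => [s|k t IH s st] /=; first by have := height_lt s; lia.
rewrite eval_actE big1 // => i _.
rewrite big1 ?mulr0 // => j _; rewrite rep_fE.
have [sj|] := eqVneq (s i).+1 j; last by rewrite mulr0 mul0r.
rewrite IH ?mulr0 // -(leq_add2r (s i)) addnAC height_subst -sj.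
by move: st => /=; lia.
Qed.

(** This is t^k modulo the product of the t - z_i, a polynomial of degree less than [n]. For k >= n
    the filtration degree drops, which is why t^n acts by zero on the graded module. *)
Lemma ev_reduce : injective z -> forall k, exists c : 'I_n -> F,
  forall x u, ev x k u = \sum_l c l *: ev x l u.
Proof.
move=> /interpolation zP k; have [c cE] := zP (fun i => z i ^+ k).
exists c => x u; rewrite /eval_act.
under [RHS]eq_bigr => l _ do rewrite scaler_sumr.
rewrite exchange_big; apply: eq_bigr => i _; rewrite cE scaler_suml.
by apply: eq_bigr => l _; rewrite scalerA.
Qed.

Hypothesis F0 : [pchar F] =i pred0.
Local Notation gV := (gen n (ev (sl2e F)) v nilp_len).

Definition evalpt (i : 'I_n) : {mpoly F[n]} := \sum_(k < n) z i ^+ k *: 'X_k.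

Let tcoord s : V -> F := fun u => u s.

Let tcoord_scalar s : scalar (tcoord s).
Proof. by move=> c u u'; rewrite /tcoord tensorP. Qed.

Let expo s : 'X_{1..n} := [multinom (s i : nat) | i < n].

(** In the symmetric power, exp(y e) Y^(a-1) = (Y + y X)^(a-1); the binomial coefficients are those
    of this expansion. *)
Let coef s : F := \prod_i 'C((a i).-1, s i)%:R.

Lemma evalpt_deriv i k : (evalpt i)^`M(k) = (z i ^+ k)%:MP.
Proof.
rewrite /evalpt; have := mderiv_lincomb k (fun k => (z i ^+ k)%:MP_[n]).
under eq_bigr do rewrite mulrC mul_mpolyC.
by move=> ->; rewrite big1 ?addr0 // => j _; rewrite mderivC mulr0.
Qed.

Let psi s : {mpoly F[n]} := subst evalpt (coef s *: 'X_[expo s]).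

Let psi_deriv s k : (psi s)^`M(k) = \sum_i z i ^+ k *:
  \sum_(j < a i) sl2_rep (a i) (sl2e F) (s i) j *: psi (subst_index s j).
Proof.
rewrite [LHS](@mmap_chain_rule F _ _ (@mpolyC n F) evalpt (mderiv k)
  (mderivD k) (mderivM k) (mderivC k)).
apply: eq_bigr => i _; rewrite evalpt_deriv mulrC mul_mpolyC; congr (_ *: _).
rewrite -/(subst evalpt _) mderivZ mderivX substZ substZ scalerA mnmE.
case si: (s i : nat) => [|j].
  rewrite mulr0 scale0r big1 // => j _.
  by rewrite rep_eE si mulr0 scale0r.
have ja : (j < a i)%N by have := ltn_ord (s i); lia.
rewrite (bigD1 (Ordinal ja)) //= big1 ?addr0 => [|j' jj']; last first.
  by rewrite rep_eE si eqSS eq_sym (negPf (_ : j' != j :> nat)) ?mulr0 ?scale0r.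
rewrite rep_eE si /= eqxx mulr1 /psi substZ scalerA. congr (_ *: subst evalpt 'X_[_]).
  rewrite /coef (bigD1 i) //= [in RHS](bigD1 i) //= subst_index_in /= si.
  rewrite mulrAC mulrA; congr (_ * _).
    rewrite -!natrM; congr _%:R.
    by rewrite mulnC mul_bin_left.
  by apply: eq_bigr => k' ki; rewrite subst_index_out 1?eq_sym.
apply/mnmP => k'; rewrite mnmBE !mnmE.
have [<-|ik] := eqVneq i k'; first by rewrite subst_index_in si /= subn1.
by rewrite subst_index_out // subn0.
Qed.

(** Both sides, as families in [s], satisfy the same linear system of differential equations and
    agree at 0. The span of the differences is therefore closed under partial derivatives and the
    Taylor criterion applies. *)
Lemma gen_tcoord s : gV (tcoord s) = psi s.
Proof.
apply/eqP; rewrite -subr_eq0; apply/eqP.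
pose D s := gV (tcoord s) - psi s; rewrite -/(D s).
apply: (mpoly_taylor_eq0 F0 (Z := lspan (fun p => exists s, p = D s))); last first.
- by apply: lspan_gen; exists s.
- move=> p i; apply: lspan_linear => _ [s' ->]; rewrite /D linearB /=.
  rewrite psi_deriv gen_deriv //; [|exact: ev_ee|exact: ev_e_nilp].
  have -> : gV (fun u => tcoord s' (ev (sl2e F) i u)) = \sum_l z l ^+ i *:
    \sum_(j < a l) sl2_rep (a l) (sl2e F) (s' l) j *: gV (tcoord (subst_index s' j)).
    transitivity (gV (fun u => \sum_l z l ^+ i * \sum_(j < a l)
       sl2_rep (a l) (sl2e F) (s' l) j * tcoord (subst_index s' j) u)).
      by congr gen; apply/funext => u; apply: eval_actE.
    rewrite gen_sum; apply: eq_bigr => l _; rewrite genZ gen_sum; congr (_ *: _).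
    by apply: eq_bigr => j _; rewrite genZ.
  rewrite -sumrB; apply: lspan_sum => l _; rewrite -scalerBr -sumrB.
  apply: lspanZ; apply: lspan_sum => j _; rewrite -scalerBr; apply: lspanZ.
  by apply: lspan_gen; exists (subst_index s' j).
move=> p; elim=> [|c _ y [s' ->] _ IH]; first by rewrite mcoeff0.
rewrite mcoeffD mcoeffZ IH addr0 /D mcoeffB gen_coef0 //.
rewrite /psi -meval_at0 subst_meval.
have y0 i : (evalpt i).@[fun=> 0] = 0.
  by rewrite raddf_sum big1 // => k _; rewrite /= mevalZ mevalXU mulr0.
rewrite (meval_eq _ y0) mevalZ mevalX /tcoord ffunE.
case: forallP => [s0|/forallP].
  rewrite big1 /coef ?big1 ?mulr1 ?subrr ?mulr0 // => i _.
    by rewrite (eqP (s0 i)) bin0.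
  by rewrite mnmE (eqP (s0 i)).
rewrite negb_forall => /existsP[i si].
by rewrite (bigD1 i) //= mnmE expr0n (negPf si) mul0r mulr0 subr0 mulr0.
Qed.

Lemma gen_monomial (m : 'I_n -> nat) : (forall i, m i < a i)%N ->
  exists2 xi : V -> F, scalar xi & gV xi = \prod_i evalpt i ^+ m i.
Proof.
move=> ma; pose s : multi_index a := [ffun i => Ordinal (ma i)].
have c0 : coef s != 0.
  apply/prodf_neq0 => i _; rewrite ((pcharf0P F).1 F0) -lt0n bin_gt0 ffunE /=.
  by have := ma i; lia.
exists (fun u => (coef s)^-1 * tcoord s u).
  by move=> c u u'; rewrite tcoord_scalar; ring.
rewrite genZ gen_tcoord /psi substZ scalerA mulVf // scale1r /subst mmapX.
by apply: eq_bigr => i _; rewrite mnmE ffunE.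
Qed.

End LowestVector.

(** * The fusion product *)

Section VspanLinear.
Variables (F : fieldType) (V W : vectType F).

Lemma vspan_linear (g : {linear V -> W}) (P : V -> Prop) (U : {vspace W}) :
  (forall u, P u -> g u \in U) -> forall u, u \in vspan P -> g u \in U.
Proof.
move=> gP u Pu; suff /subvP/(_ _ Pu) : (vspan P <= (linfun g @^-1: U)%VF)%VS.
  by rewrite -memv_preim lfunE.
by apply: vspan_sub => w Pw; rewrite -memv_preim lfunE gP.
Qed.

End VspanLinear.

Section Filtration.
Variables (F : fieldType) (n : nat) (a : 'I_n -> nat) (z : 'I_n -> F).
Hypothesis z_inj : injective z.
Local Notation V := (tensor F a).
Local Notation ev := (@eval_act F n a z).
Local Notation v := (lowest_vector F a).
Local Notation filt := (fusion_filt a z).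
Local Notation filt_pred := (fusion_filt_pred a z).
Local Notation len := (fusion_len a z).
Implicit Types (u : V) (t : seq nat).

Definition ev_lin x k : {linear V -> V} :=
  HB.pack (ev x k) (GRing.isLinear.Build F V V *:%R (ev x k) (eval_act_linear z x k)).

Lemma ev0 x k : ev x k 0 = 0.
Proof. exact: (linear0 (ev_lin x k)). Qed.

Lemma evB x k u u' : ev x k (u - u') = ev x k u - ev x k u'.
Proof. exact: (linearB (ev_lin x k)). Qed.

Lemma filt_mono i j : (i <= j)%N -> (filt i <= filt j)%VS.
Proof.
move=> ij; apply: vspan_sub => u [s [trs les ->]]; apply: mem_vspan.
by exists s; split=> //; apply: leq_trans ij.
Qed.

Lemma filt_act x k m u : \tr x == 0 -> u \in filt m -> ev x k u \in filt (m + k).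
Proof.
move=> trx; apply: (@vspan_linear _ _ _ (ev_lin x k)) => {}u [s [trs les ->]].
apply: mem_vspan; exists ((x, k) :: s); split=> //=; first by rewrite trx.
by rewrite addnC leq_add2r.
Qed.

Lemma filt_pred_act x k m u : \tr x == 0 -> u \in filt_pred m -> ev x k u \in filt_pred (m + k).
Proof.
move=> trx; case: m => [|m] /=; last exact: filt_act.
by rewrite memv0 => /eqP ->; rewrite ev0 mem0v.
Qed.

Lemma filt_sub_pred i j : (i < j)%N -> (filt i <= filt_pred j)%VS.
Proof. by case: j => // j ij; apply: filt_mono. Qed.

Lemma filt_reduce x k m u : (n <= k)%N -> \tr x == 0 -> u \in filt m ->
  ev x k u \in filt_pred (m + k).
Proof.
move=> nk trx um; have [c ->] := ev_reduce a z_inj k.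
apply: rpred_sum => l _; apply: rpredZ; apply: (subvP (filt_sub_pred _)) (filt_act l trx um).
by rewrite ltn_add2l (leq_trans (ltn_ord l)).
Qed.

Lemma lowest_filt : v \in filt 0.
Proof. by apply: mem_vspan; exists [::]. Qed.

Lemma filt_stable m : (len <= m)%N -> filt m = filt len.
Proof.
by rewrite /fusion_len; case: ex_minnP => N /asboolP stN _; apply: stN.
Qed.

(** Already the words in the [e_k], [k < n], of weight at most [m] span
    [V^(m)]. *)
Definition e_span m : {vspace V} :=
  vspan (fun u => exists t, [/\ all (fun k => k < n)%N t, (sumn t <= m)%N &
                               u = word (ev (sl2e F)) t v]).

Lemma e_span_mono i j : (i <= j)%N -> (e_span i <= e_span j)%VS.
Proof.
move=> ij; apply: vspan_sub => u [t [tn ti ->]]; apply: mem_vspan.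
by exists t; split=> //; apply: leq_trans ij.
Qed.

Lemma e_span_e k m u : u \in e_span m -> ev (sl2e F) k u \in e_span (m + k).
Proof.
move=> um.
have small l : (l < n)%N -> ev (sl2e F) l u \in e_span (m + l).
  move=> ln; apply: (@vspan_linear _ _ _ (ev_lin (sl2e F) l)) um => {}u [t [tn tm ->]].
  apply: mem_vspan; exists (l :: t); split=> //=; first by rewrite ln.
  by rewrite addnC leq_add2r.
have [kn|nk] := ltnP k n; first exact: small.
have [c ->] := ev_reduce a z_inj k; apply: rpred_sum => l _; apply: rpredZ.
apply: (subvP (e_span_mono _)) (small l (ltn_ord l)).
by rewrite leq_add2l ltnW // (leq_trans (ltn_ord l)).
Qed.

Lemma e_span_word t m : all (fun k => k < n)%N t -> (sumn t <= m)%N ->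
  word (ev (sl2e F)) t v \in e_span m.
Proof. by move=> tn tm; apply: mem_vspan; exists t. Qed.

Lemma e_span_h k m u : u \in e_span m -> ev (sl2h F) k u \in e_span (m + k).
Proof.
apply: (@vspan_linear _ _ _ (ev_lin (sl2h F) k)) => {}u [t [tn tm ->]].
apply: (subvP (e_span_mono (leq_add tm (leqnn k)))) => /=.
elim: t tn {tm} => /= [_|l t IH /andP[ln tn]].
  by rewrite ev_h_lowest; apply: rpredZ; apply: (@e_span_word [::]).
rewrite ev_he; apply: rpredD.
  by rewrite -addnA addnC; apply: e_span_e; apply: IH.
rewrite (_ : l + sumn t + k = sumn t + (k + l))%N; last by lia.
apply: rpredZ.
by apply: e_span_e; apply: e_span_word.
Qed.

Lemma e_span_f k m u : u \in e_span m -> ev (sl2f F) k u \in e_span (m + k).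
Proof.
apply: (@vspan_linear _ _ _ (ev_lin (sl2f F) k)) => {}u [t [tn tm ->]].
apply: (subvP (e_span_mono (leq_add tm (leqnn k)))) => /=.
elim: t tn {tm} => /= [_|l t IH /andP[ln tn]].
  by rewrite ev_f_lowest mem0v.
rewrite ev_fe; apply: rpredD.
  by rewrite -addnA addnC; apply: e_span_e; apply: IH.
rewrite (_ : l + sumn t + k = sumn t + (k + l))%N; last by lia.
apply: rpredZ.
by apply: e_span_h; apply: e_span_word.
Qed.

(** Straightening: h and f move to the right past the e's, with brackets of the same total weight,
    until they reach [v]. Functionals on the filtration can then be tested on words in e alone. *)
Lemma filt_e_span m : (filt m <= e_span m)%VS.
Proof.
apply: vspan_sub => _ [s [trs les ->]]; apply: (subvP (e_span_mono les)).
elim: s trs {les} => /= [_|[x k] s IH /= /andP[trx /IH us]].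
  exact: (@e_span_word [::]).
rewrite {1}(sl2_decomp trx) addnC; move: (foldr _ _ _) us => u us.
rewrite -addrA !eval_actP -[x 0 0 *: _]addr0 eval_actP.
rewrite !rpredD ?rpredZ //; [exact: e_span_e|exact: e_span_f|exact: e_span_h|].
rewrite /eval_act big1 ?mem0v // => i _; rewrite factor_actE.
have -> : sl2_rep (a i) 0 = 0 :> 'M[F]_(a i) by apply/matrixP => p q; rewrite !mxE; ring.
rewrite (_ : factor_mx _ _ = 0) ?scaler0 //; apply/ffunP => q; rewrite !ffunE big1 // => j _.
by rewrite mxE mul0r.
Qed.

End Filtration.

Section Fusion.
Variables (F : fieldType) (n : nat) (a : 'I_n -> nat) (z : 'I_n -> F).
Hypothesis z_inj : injective z.
Local Notation V := (tensor F a).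
Local Notation M := (fusion a z).
Local Notation ev := (@eval_act F n a z).
Local Notation v := (lowest_vector F a).
Local Notation filt := (fusion_filt a z).
Local Notation filt_pred := (fusion_filt_pred a z).
Local Notation len := (fusion_len a z).
Local Notation gr := (@gr_class F n a z).
Local Notation piece := (gr_piece a z).
Local Notation act := (@fusion_act F n a z).
Implicit Types (u : V) (t : seq nat) (x y w : 'M[F]_2).

Lemma gr_linear m : linear (gr m).
Proof. by move=> c u u'; rewrite /gr_class linearP. Qed.

Definition gr_lin m : {linear V -> V} :=
  HB.pack (gr m) (GRing.isLinear.Build F V V *:%R (gr m) (gr_linear m)).

Lemma gr0 m : gr m 0 = 0. Proof. exact: (linear0 (gr_lin m)). Qed.

Lemma grB m u u' : gr m (u - u') = gr m u - gr m u'.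
Proof. exact: (linearB (gr_lin m)). Qed.

Lemma gr_piece_mem m u : gr m u \in piece m.
Proof. exact: memv_pi. Qed.

Lemma gr_piece_id m u : u \in piece m -> gr m u = u.
Proof. by move=> um; apply: daddv_pi_id; rewrite ?capv_diff. Qed.

Lemma gr_piece_filt m u : u \in piece m -> u \in filt m.
Proof. exact: (subvP (diffvSl _ _)). Qed.

Lemma gr_pred m u : u \in filt m -> u - gr m u \in filt_pred m.
Proof.
move=> um; have /addv_pi1_pi2 : u \in (filt m + filt_pred m)%VS.
  exact: (subvP (addvSl _ _)).
by move=> {1}<-; rewrite addrC addKr memv_pi2.
Qed.

Lemma gr_pred_eq0 m u : u \in filt_pred m -> gr m u = 0.
Proof.
move=> um; have /addv_pi1_pi2 : u \in (filt m + filt_pred m)%VS.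
  exact: (subvP (addvSr _ _)).
by rewrite addv_pi2_id // => /(canRL (addrK _)); rewrite subrr.
Qed.

Lemma gr_eq m u u' : u - u' \in filt_pred m -> gr m u = gr m u'.
Proof. by move=> /gr_pred_eq0; rewrite grB => /eqP; rewrite subr_eq0 => /eqP. Qed.

Lemma gr_large m u : (len < m)%N -> gr m u = 0.
Proof.
move=> lm; rewrite -(gr_piece_id (gr_piece_mem m u)); apply: gr_pred_eq0.
case: m lm => // m lm /=; rewrite [filt m]filt_stable // -(@filt_stable _ _ _ _ m.+1) ?(ltnW lm) //.
exact/gr_piece_filt/gr_piece_mem.
Qed.

Lemma gr_spaceP (f : {ffun 'I_len.+1 -> V}) : reflect (forall m, f m \in piece m) (f \in gr_space a z).
Proof.
apply: (iffP idP) => [fgr m|]; last exact: mem_vspan.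
pose pr (m : 'I_len.+1) (f : {ffun 'I_len.+1 -> V}) : V := f m.
have pr_lin c : linear (pr c) by move=> d g g'; rewrite /pr !ffunE.
pose prl c : {linear {ffun 'I_len.+1 -> V} -> V} :=
  HB.pack (pr c) (GRing.isLinear.Build F {ffun 'I_len.+1 -> V} V *:%R (pr c) (pr_lin c)).
by apply: (@vspan_linear _ _ _ (prl m)) fgr => g /(_ m).
Qed.

(** The component of degree [m]; it vanishes for [m > len]. *)
Definition gc (m : nat) (u : M) : V :=
  if insub m is Some i then vsval u (i : 'I_len.+1) else 0.

Lemma gc_linear m : linear (gc m).
Proof.
move=> c u u'; rewrite /gc; case: insub => [i|]; last by rewrite scaler0 addr0.
by rewrite linearP !ffunE.
Qed.

Definition gc_lin m : {linear M -> V} :=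
  HB.pack (gc m) (GRing.isLinear.Build F M V *:%R (gc m) (gc_linear m)).

Lemma gc0 m : gc m 0 = 0. Proof. exact: (linear0 (gc_lin m)). Qed.

Lemma gcZ m c (u : M) : gc m (c *: u) = c *: gc m u.
Proof. by rewrite -[c *: u]addr0 gc_linear gc0 addr0. Qed.

Lemma gc_piece m (u : M) : gc m u \in piece m.
Proof.
rewrite /gc; case: insubP => [i _ <-|_]; last exact: mem0v.
by have /gr_spaceP := subvsP u; apply.
Qed.

Lemma gc_filt m (u : M) : gc m u \in filt m.
Proof. exact/gr_piece_filt/gc_piece. Qed.

Lemma gr_gc m (u : M) : gr m (gc m u) = gc m u.
Proof. exact/gr_piece_id/gc_piece. Qed.

Lemma gc_ext (u u' : M) : (forall m, gc m u = gc m u') -> u = u'.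
Proof.
move=> uu'; apply/val_inj/ffunP => i; have := uu' i.
by rewrite /gc valK.
Qed.

Lemma gc_vsproj m (f : {ffun 'I_len.+1 -> V}) : (forall m, f m \in piece m) ->
  gc m (vsproj (gr_space a z) f) = if insub m is Some i then f i else 0.
Proof. by move=> /gr_spaceP fgr; rewrite /gc vsprojK. Qed.

Lemma gc_act m x k (u : M) :
  gc m (act x k u) = if (k <= m)%N then gr m (ev x k (gc (m - k) u)) else 0.
Proof.
rewrite /fusion_act gc_vsproj => [|i]; last first.
  by rewrite ffunE; apply: rpred_sum => j _; apply: gr_piece_mem.
case: insubP => [i im mi|]; last first.
  by rewrite -leqNgt => lm; rewrite gr_large // if_same.
rewrite ffunE; case: leqP => [km|mk]; last first.
  rewrite big_pred0 // => j; apply/negP => /eqP; rewrite mi => jk.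
  by move: mk; rewrite -jk ltnNge leq_addl.
have jl : (m - k < len.+1)%N := leq_ltn_trans (leq_subr _ _) im.
rewrite (bigD1 (Ordinal jl)) /=; last by rewrite subnK // mi.
rewrite big1 ?addr0 => [|j /andP[/eqP jk /eqP jj]]; last first.
  have jk' : (j + k = m)%N by rewrite jk mi.
  by case: jj; apply/val_inj; rewrite /= -jk' addnK.
rewrite mi /gc; case: insubP => [j _ jE|/negP //].
by congr (gr _ (ev _ _ (vsval u _))); apply/val_inj; rewrite /= jE.
Qed.

Lemma act_linear x k : linear (act x k).
Proof.
move=> c u u'; apply: gc_ext => m; rewrite gc_linear !gc_act.
case: leqP => _; last by rewrite scaler0 addr0.
by rewrite gc_linear eval_act_linear gr_linear.
Qed.

(** The action is well defined on classes: [u] and its representative differ by an element of the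
    preceding filtration step, which [ev x k] carries into the step preceding [m]. *)
Lemma gr_ev m x k u : \tr x == 0 -> (k <= m)%N -> u \in filt (m - k) ->
  gr m (ev x k (gr (m - k) u)) = gr m (ev x k u).
Proof.
move=> trx km um; apply/esym/gr_eq; rewrite -evB -{2}(subnK km).
by apply: filt_pred_act => //; apply: gr_pred.
Qed.

Lemma gc_act2 m x k y l (u : M) : \tr x == 0 -> \tr y == 0 ->
  gc m (act x k (act y l u)) =
    if (k + l <= m)%N then gr m (ev x k (ev y l (gc (m - (k + l)) u))) else 0.
Proof.
move=> trx tr_y; rewrite !gc_act subnDA; case: (leqP k m) => km; last first.
  by case: leqP => //; lia.
case: leqP => [lm|ml]; last by rewrite ev0 gr0; case: leqP => //; lia.
case: leqP => [_|]; last lia.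
rewrite gr_ev //; rewrite -{2}(subnK lm).
by apply: filt_act => //; apply: gc_filt.
Qed.

Lemma act_comm c x y w : \tr x == 0 -> \tr y == 0 ->
    (forall k l u, ev x k (ev y l u) = ev y l (ev x k u) + c *: ev w (k + l) u) ->
  forall k l (u : M), act x k (act y l u) = act y l (act x k u) + c *: act w (k + l) u.
Proof.
move=> trx tr_y xy k l u; apply: gc_ext => m.
rewrite [in RHS]addrC gc_linear !gc_act2 // gc_act [(l + k)%N]addnC.
case: leqP => _; last by rewrite scaler0 addr0.
by rewrite xy [in LHS]addrC gr_linear.
Qed.

Lemma gc_word m x t (u : M) : \tr x == 0 -> gc m (word (act x) t u) =
  if (sumn t <= m)%N then gr m (word (ev x) t (gc (m - sumn t) u)) else 0.
Proof.
move=> trx; elim: t m => [|k t IH] m /=; first by rewrite subn0 gr_gc.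
rewrite gc_act IH; case: (leqP k m) => km; last by case: leqP => //; lia.
case: leqP => [lm|ml]; last by rewrite ev0 gr0; case: leqP => //; lia.
case: leqP => [_|]; last lia.
rewrite gr_ev // ?subnDA //.
have filt_word t' i u' : u' \in filt i -> word (ev x) t' u' \in filt (i + sumn t').
  move=> ui; elim: t' => [|k' t' IH'] /=; first by rewrite addn0.
  by rewrite addnCA addnC; apply: filt_act.
by have := filt_word t _ _ (gc_filt (m - k - sumn t) u); rewrite subnK.
Qed.

Lemma gc_vector m : gc m (fusion_vector a z) = if m == 0%N then v else 0.
Proof.
have gr0v : gr 0 v = v.
  have := gr_pred (lowest_filt a z); rewrite memv0 subr_eq0 => /eqP/esym; exact.
rewrite /fusion_vector gc_vsproj => [|i]; last first.
  rewrite ffunE; case: eqP => [->|_]; last exact: mem0v.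
  exact: gr_piece_mem.
case: insubP => [i im <-|]; first by rewrite ffunE gr0v.
by case: eqP => // ->.
Qed.

Lemma word_nilp x N : \tr x == 0 -> (forall t u, size t = N -> word (ev x) t u = 0) ->
  forall t (u : M), size t = N -> word (act x) t u = 0.
Proof.
move=> trx nilp t u tN; apply: gc_ext => m.
by rewrite gc_word // nilp // gr0 if_same gc0.
Qed.

Let tre := let: And3 p _ _ := sl2_trace F in p.
Let trf := let: And3 _ p _ := sl2_trace F in p.
Let trh := let: And3 _ _ p := sl2_trace F in p.

Lemma act_ee k l (u : M) : act (sl2e F) k (act (sl2e F) l u) = act (sl2e F) l (act (sl2e F) k u).
Proof.
rewrite (@act_comm 0 _ _ 0) ?tre ?scale0r ?addr0 // => k' l' u'.
by rewrite ev_ee scale0r addr0.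
Qed.

Lemma act_he k l (u : M) : act (sl2h F) k (act (sl2e F) l u) =
  act (sl2e F) l (act (sl2h F) k u) + 2%:R *: act (sl2e F) (k + l) u.
Proof. by apply: act_comm; rewrite ?tre ?trh // => *; apply: ev_he. Qed.

Lemma act_fe k l (u : M) : act (sl2f F) k (act (sl2e F) l u) =
  act (sl2e F) l (act (sl2f F) k u) - act (sl2h F) (k + l) u.
Proof. by rewrite -scaleN1r; apply: act_comm; rewrite ?tre ?trf // => *; apply: ev_fe. Qed.

Lemma act_f_vector k : act (sl2f F) k (fusion_vector a z) = 0.
Proof.
apply: gc_ext => m; rewrite gc_act gc_vector gc0; case: leqP => // _.
by case: eqP; rewrite ?ev_f_lowest ?ev0 gr0.
Qed.

(** For k > 0 the vector h_k v is a multiple of v, hence lies in V^(0) and so in V^(k-1): its class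
    in degree k is zero. *)
Lemma act_h_vector k : act (sl2h F) k (fusion_vector a z) =
  (if k == 0%N then lowest_weight a z 0 else 0) *: fusion_vector a z.
Proof.
apply: gc_ext => m; rewrite gc_act gcZ !gc_vector.
case: (leqP k m) => km; last first.
  by rewrite (gtn_eqF (leq_ltn_trans (leq0n m) km)) scale0r.
have [->|k0] := eqVneq k 0%N.
  rewrite subn0; case: eqP => [->|_]; last by rewrite ev0 gr0 scaler0.
  rewrite ev_h_lowest gr_piece_id //; apply: rpredZ.
  by have := gc_piece 0 (fusion_vector a z); rewrite gc_vector eqxx.
rewrite scale0r; case: eqP => mk; last by rewrite ev0 gr0.
rewrite ev_h_lowest; apply: gr_pred_eq0; apply: rpredZ.
by apply: (subvP (filt_sub_pred _ _ _)) (lowest_filt a z); lia.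
Qed.

Lemma act_e_trunc k (u : M) : (n <= k)%N -> act (sl2e F) k u = 0.
Proof.
move=> nk; apply: gc_ext => m; rewrite gc_act gc0; case: leqP => // km.
by apply: gr_pred_eq0; rewrite -{2}(subnK km) filt_reduce ?tre // gc_filt.
Qed.

End Fusion.

(** * Initial forms *)

Section Weights.
Variables (F : fieldType) (n : nat).
Local Notation S := {mpoly F[n]}.
Implicit Types (p : S) (t : seq 'I_n).

(** Giving the weight [k] to ['X_k], the coefficient of ['X^d] in [theta p] is the
    component of weight [d] of [p]. *)
Definition theta : S -> {poly S} :=
  mmap (polyC \o @mpolyC n F) (fun k : 'I_n => ('X_k : S)%:P * 'X^k).

HB.instance Definition _ := GRing.RMorphism.copy theta
  (mmap (polyC \o @mpolyC n F) (fun k : 'I_n => ('X_k : S)%:P * 'X^k)).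

Lemma thetaX k : theta 'X_k = ('X_k)%:P * 'X^k.
Proof. by rewrite /theta mmapX mmap1U. Qed.

Lemma thetaZ c p : theta (c *: p) = (c%:MP)%:P * theta p.
Proof. by rewrite /theta mmapZ. Qed.

Lemma thetaD p q : theta (p + q) = theta p + theta q.
Proof. exact: mmapD. Qed.

Lemma theta_deriv k p : map_poly (mderiv k) (theta p) = 'X^k * theta p^`M(k).
Proof.
have coef_d (q : {poly S}) d : (map_poly (mderiv k) q)`_d = (q`_d)^`M(k).
  by rewrite coef_map_id0 ?mderiv0.
rewrite [LHS](@mmap_chain_rule F n _ (polyC \o @mpolyC n F) _ (map_poly (mderiv k))).
- rewrite (bigD1 k) //= big1 ?addr0 => [|i ik].
    rewrite mulrC; congr (_ * _); apply/polyP => d; rewrite coef_d coefXn coefCM coefXn mulrC.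
    by case: eqP => _; rewrite ?mul0r ?mul1r ?mderiv0 // mderiv_var eqxx.
  have -> : map_poly (mderiv k) (('X_i : S)%:P * 'X^i) = 0.
    apply/polyP => d; rewrite coef_d coefCM coefXn coef0.
    by case: eqP => _; rewrite ?mulr0 ?mderiv0 // mulr1 mderiv_var (negPf ik).
  by rewrite mulr0.
- by move=> q r; apply/polyP => d; rewrite !(coef_d, coefD) mderivD.
- move=> q r; apply/polyP => d; rewrite coef_d coefM linear_sum coefD !coefM -big_split.
  by apply: eq_bigr => i _; rewrite /= mderivM !coef_d.
- by move=> c; rewrite /= map_polyC /= mderivC.
Qed.

Lemma theta_coef0 p d : ((theta p)`_d)@_0 = (d == 0%N)%:R * p@_0.
Proof.
pose mu : {rmorphism {poly S} -> {poly F}} := map_poly (mcoeff 0%MM).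
suff : mu (theta p) = (p@_0)%:P.
  move=> /(congr1 (fun q : {poly F} => q`_d)); rewrite coef_map coefC /= => ->.
  by case: eqP => _; rewrite ?mul1r ?mul0r.
elim/mpolyind: p => [|c m p _ _ IH]; first by rewrite mcoeff0 [theta 0]mmap0 (rmorph0 mu).
rewrite thetaD (rmorphD mu) mcoeffD polyCD; congr (_ + _); last exact: IH.
have muC y : mu y%:P = (y@_0)%:P by exact: map_polyC.
rewrite thetaZ (rmorphM mu) muC mcoeffC eqxx mulr1 mcoeffZ polyCM; congr (_ * _).
rewrite /theta mmapX (rmorph_prod mu) mcoeffX.
have [->|] := eqVneq m 0%MM.
  by rewrite big1 // => i _; rewrite mnm0E expr0 (rmorph1 mu).
rewrite -mdeg_eq0 mdegE sum_nat_eq0 negb_forall => /existsP[i /= mi].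
rewrite (bigD1 i) //= (rmorphXn mu) (rmorphM mu) muC mcoeffX -mdeg_eq0 mdeg1.
by rewrite mul0r expr0n (negPf mi) mul0r.
Qed.

Definition derivs t p : S := foldr (fun i q => q^`M(i)) p t.

Lemma derivs0 t : derivs t 0 = 0.
Proof. by elim: t => //= i t ->; rewrite mderiv0. Qed.

Lemma theta_derivs t p d : derivs t (theta p)`_d =
  if (\sum_(i <- t) i <= d)%N then (theta (derivs t p))`_(d - \sum_(i <- t) i) else 0.
Proof.
elim: t => [|i t IH]; first by rewrite big_nil subn0.
rewrite big_cons /= -/(derivs t _) IH; case: leqP => td; last first.
  by rewrite mderiv0; case: leqP => //; lia.
have -> : ((theta (derivs t p))`_(d - \sum_(j <- t) j))^`M(i) =
    (map_poly (mderiv i) (theta (derivs t p)))`_(d - \sum_(j <- t) j).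
  by rewrite coef_map_id0 ?mderiv0.
rewrite theta_deriv coefXnM; move: (theta _) (\sum_(j <- t) j)%N td => q s td.
rewrite addnC subnDA ltnNge -(leq_add2l s) subnKC //.
by case: leqP.
Qed.

Lemma derivs_theta0 t p d : (derivs t (theta p)`_d)@_0 =
  (d == (\sum_(i <- t) i)%N)%:R * (derivs t p)@_0.
Proof.
rewrite theta_derivs; case: leqP => td; last by rewrite mcoeff0 ltn_eqF // mul0r.
by rewrite theta_coef0 subn_eq0; congr (_%:R * _); rewrite eqn_leq td andbT.
Qed.

Hypothesis F0 : [pchar F] =i pred0.

Lemma derivs_inj p q : (forall t, (derivs t p)@_0 = (derivs t q)@_0) -> p = q.
Proof.
move=> pq; apply/eqP; rewrite -subr_eq0; apply/eqP.
have dB t : derivs t (p - q) = derivs t p - derivs t q.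
  by elim: t => //= i t ->; rewrite mderivB.
apply: (mpoly_taylor_eq0 F0 (Z := fun r => exists t, r = derivs t (p - q))).
- by move=> _ [t ->]; rewrite dB mcoeffB pq subrr.
- by move=> _ i [t ->]; exists (i :: t).
- by exists [::].
Qed.

(** [x] is the lowest component of [P], possibly zero, up to a shift of the
    weights. *)
Definition initial_form (P x : S) := exists c b R, 'X^c * theta P = 'X^b * (x%:P + 'X * R).

Lemma initial_form1 : initial_form 1 1.
Proof. by exists 0%N, 0%N, 0; rewrite rmorph1 mulr0 addr0 polyC1. Qed.

Lemma initial_formM P Q x y :
  initial_form P x -> initial_form Q y -> initial_form (P * Q) (x * y).
Proof.
move=> [c [b [R Px]]] [c' [b' [R' Qy]]].
exists (c + c')%N, (b + b')%N, (x%:P * R' + R * y%:P + 'X * R * R').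
rewrite rmorphM !exprD mulrACA Px Qy polyCM; ring.
Qed.

Lemma initial_form_coef P x : initial_form P x ->
  x = 0 \/ exists w, (theta P)`_w = x /\ forall d, (d < w)%N -> (theta P)`_d = 0.
Proof.
move=> [c [b [R E]]]; have [bc|cb] := ltnP b c.
  left; have := congr1 (fun q : {poly S} => q`_b) E; rewrite coefXnM bc.
  by rewrite coefXnM ltnn subnn coefD coefC coefXM eqxx addr0 => <-.
right; exists (b - c)%N.
have cE d : (theta P)`_d = ('X^b * (x%:P + 'X * R))`_(d + c).
  by rewrite -E coefXnM ltnNge leq_addl addnK.
split=> [|d db]; rewrite cE coefXnM.
  by rewrite subnK // ltnn subnn coefD coefC coefXM eqxx addr0.
by rewrite ifT //; lia.
Qed.

End Weights.

(** Up to factorials, the Taylor coefficients of a generating function are the values of the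
    functional on words in [e]. This dictionary relates initial forms to the filtration. *)
Lemma gen_derivs (F : fieldType) (F0 : [pchar F] =i pred0) n (M : vectType F)
    (e : nat -> M -> M) v K (xi : M -> F) (t : seq 'I_n) :
  (forall k, linear (e k)) -> (forall i j u, e i (e j u) = e j (e i u)) ->
  (forall t u, size t = K -> word e t u = 0) -> scalar xi -> (0 < K)%N ->
  (derivs t (gen n e v K xi))@_0 = xi (word e (rev (map val t)) v).
Proof.
move=> e_lin eC e0 xi_lin K0.
suff -> : derivs t (gen n e v K xi) = gen n e v K (fun u => xi (word e (rev (map val t)) u)).
  by rewrite gen_coef0.
elim: t => //= i t ->; rewrite gen_deriv //.
  by congr gen; apply/funext => u; rewrite rev_cons -cats1 /word foldr_cat.
by move=> c u u'; rewrite word_linear // xi_lin.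
Qed.

Section FusionGenerating.
Variables (F : fieldType) (n : nat) (a : 'I_n -> nat) (z : 'I_n -> F).
Hypothesis F0 : [pchar F] =i pred0.
Hypothesis z_inj : injective z.
Local Notation V := (tensor F a).
Local Notation M := (fusion a z).
Local Notation ev := (@eval_act F n a z).
Local Notation v := (lowest_vector F a).
Local Notation filt := (fusion_filt a z).
Local Notation filt_pred := (fusion_filt_pred a z).
Local Notation len := (fusion_len a z).
Local Notation act := (@fusion_act F n a z).
Local Notation gV := (gen n (ev (sl2e F)) v (nilp_len a)).
Local Notation gM := (gen n (act (sl2e F)) (fusion_vector a z) (nilp_len a)).

Lemma pieces_indep L (g : nat -> V) : (forall m, g m \in gr_piece a z m) ->
  \sum_(m < L) g m = 0 -> forall m, (m < L)%N -> g m = 0.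
Proof.
move=> gp; elim: L => // L IH; rewrite big_ord_recr /= => sum0 m.
have gL : g L = 0.
  rewrite -(gr_piece_id (gp L)); apply: gr_pred_eq0.
  move/eqP: sum0; rewrite addr_eq0 => /eqP/esym/(canRL opprK) ->.
  rewrite rpredN; apply: rpred_sum => i _.
  exact: (subvP (filt_sub_pred _ _ (ltn_ord i))) (gr_piece_filt (gp i)).
move: sum0; rewrite gL addr0 => /IH{}IH.
by rewrite ltnS leq_eqVlt => /predU1P[->|/IH].
Qed.

Lemma dim_tensor : \dim {:V} = (\prod_i a i)%N.
Proof.
rewrite dimvf; transitivity #|{: multi_index a}|; first exact: muln1.
rewrite card_dep_ffun foldrE big_image /=.
by apply: eq_bigr => i _; rewrite card_ord.
Qed.

(** The chosen complements [gr_piece] are independent in [V], so adding up the components embeds the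
    fusion product into the tensor product. *)
Lemma dim_fusion : (\dim {:M} <= \prod_i a i)%N.
Proof.
pose sg (u : M) : V := \sum_(m < len.+1) gc m u.
have sg_lin : linear sg.
  move=> c u u'; rewrite /sg scaler_sumr -big_split; apply: eq_bigr => m _.
  exact: gc_linear.
pose sgl : {linear M -> V} := HB.pack sg (GRing.isLinear.Build F M V *:%R sg sg_lin).
have ker0 : (fullv :&: lker (linfun sgl) = 0)%VS.
  apply/eqP; rewrite -subv0; apply/subvP => u; rewrite memv_cap memv_ker lfunE memv0 /=.
  move=> /andP[_ /eqP su]; apply/eqP/gc_ext => m; rewrite gc0.
  have [lm|lm] := ltnP m len.+1.
    by apply: (pieces_indep (g := fun m => gc m u)) su _ lm => k; apply: gc_piece.
  by rewrite /gc insubF // ltnNge lm.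
by rewrite -(limg_dim_eq ker0) -dim_tensor dimvS // subvf.
Qed.

Lemma e_span_kernel w (la : V -> F) : scalar la ->
    (forall t : seq 'I_n, (\sum_(i <- t) i < w)%N ->
       la (word (ev (sl2e F)) (rev (map val t)) v) = 0) ->
  forall u, u \in filt_pred w -> la u = 0.
Proof.
move=> la_lin la0 u; case: w la0 => [|w] la0 /=; first by rewrite memv0 => /eqP->; apply: scalar0.
move=> /(subvP (filt_e_span _ z_inj _)) uw.
pose lal : {linear V -> F^o} := HB.pack (la : V -> F^o) (GRing.isLinear.Build F V F^o *:%R la la_lin).
have : lal u \in 0%VS; last by rewrite memv0 => /eqP.
apply: (@vspan_linear _ _ _ lal) uw => _ [t [tn tw ->]]; rewrite memv0; apply/eqP.
pose t' : seq 'I_n := rev (pmap insub t).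
have tE : map val (pmap insub t : seq 'I_n) = t.
  by rewrite pmap_filter ?(eq_filter (a2 := fun k => k < n)%N) ?(all_filterP tn) //;
     [move=> k; rewrite isSome_insub | apply: insubK].
have := la0 t'; rewrite /t' map_rev revK tE; apply.
rewrite ltnS (leq_trans _ tw) // -[X in (_ <= sumn X)%N]tE sumnE big_map.
by rewrite (perm_big (pmap insub t)) // perm_rev.
Qed.

(** The initial forms of the coordinates of the tensor product are coordinates of
    its associated graded. *)
Lemma fusion_initial (la : V -> F) x : scalar la -> initial_form (gV la) x ->
  exists2 xi : M -> F, scalar xi & gM xi = x.
Proof.
move=> la_lin /initial_form_coef[->|[w [xE low]]].
  by exists (fun=> 0); [move=> c u u'; rewrite mulr0 addr0 | apply: gen0].
have eV t : (derivs t (gV la))@_0 = la (word (ev (sl2e F)) (rev (map val t)) v).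
  apply: gen_derivs => //; [exact: eval_act_linear|exact: ev_ee|exact: ev_e_nilp].
(* [gV la] has no component of weight below [w], so [la] kills all words of smaller weight and with
   them V^(w-1). It thus induces a functional on the piece of degree [w], whose generating function
   is the component of weight [w]. *)
have la0 u : u \in filt_pred w -> la u = 0.
  apply: e_span_kernel => // t tw; rewrite -eV.
  have := derivs_theta0 t (gV la) (\sum_(i <- t) i).
  by rewrite low // derivs0 mcoeff0 eqxx mul1r => <-.
have xi_lin : scalar (fun u : M => la (gc w u)).
  by move=> c u u'; rewrite gc_linear la_lin.
exists (fun u => la (gc w u)) => //; apply: (derivs_inj F0) => t.
have [tre _ _] := sl2_trace F.
rewrite gen_derivs //; first last.
- by move=> t' u; apply: word_nilp => // ? ?; apply: ev_e_nilp.
- exact: act_ee.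
- exact: act_linear.
rewrite -xE derivs_theta0 eV gc_word // gc_vector.
rewrite sumn_rev sumnE big_map.
case: leqP => [tw|wt]; last by rewrite ltn_eqF // scalar0 // mul0r.
rewrite subn_eq0; have [wE|wt] := eqVneq w (\sum_(i <- t) i)%N; last first.
  rewrite ifN ?mul0r; last by apply: contra wt => wt; rewrite eqn_leq wt tw.
  have -> : word (ev (sl2e F)) (rev [seq \val i | i <- t]) 0 = 0.
    by elim: (rev _) => //= k s ->; rewrite ev0.
  by rewrite gr0 scalar0.
rewrite ifT ?wE // mul1r; apply/eqP; rewrite -subr_eq0.
set u := word _ _ _.
have uw : u \in filt w.
  rewrite wE /u; move: (lowest_filt a z).
  have -> : (\sum_(i <- t) i = sumn (rev (map val t)))%N by rewrite sumn_rev sumnE big_map.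
  elim: (rev _) => //= k s IH v0; rewrite addnC; exact/filt_act/IH.
have := la0 _ (gr_pred uw); rewrite -scaleN1r addrC la_lin.
by move=> /eqP; rewrite mulN1r addrC -oppr_eq0 opprB wE.
Qed.

End FusionGenerating.

(** * Hankel minors as initial forms *)

Lemma dual_interpolation (F : fieldType) m (y : 'I_m -> F) (b : 'I_m -> F) :
  injective y -> exists c : 'I_m -> F, forall d : 'I_m, \sum_i c i * y i ^+ d = b d.
Proof.
move=> /vandermonde_unit Vu; set V := Vandermonde _ _ in Vu.
exists (fun i => (invmx V *m \col_i b i) i 0) => d.
have : (V *m (invmx V *m \col_i b i)) d 0 = b d by rewrite mulKVmx // mxE.
move=> <-; rewrite [RHS]mxE; apply: eq_bigr => i _.
by rewrite mulrC; congr (_ * _); rewrite /V !mxE.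
Qed.

Lemma det_scale_rows_cols (R : comNzRingType) r (al be : 'I_r -> R) (A : 'M[R]_r) :
  \det (\matrix_(i, j) (al i * be j * A i j)) = (\prod_i al i) * (\prod_j be j) * \det A.
Proof.
rewrite /determinant mulr_sumr; apply: eq_bigr => s _.
rewrite mulrCA; congr (_ * _).
under eq_bigr do rewrite mxE.
rewrite !big_split /=; congr (_ * _ * _).
by rewrite [RHS](reindex_inj (@perm_inj _ s)).
Qed.

Lemma poly_const_mulX (R : nzRingType) (q : {poly R}) : exists r, q = (q.[0])%:P + 'X * r.
Proof.
elim/poly_ind: q => [|q c _]; first by exists 0; rewrite horner0 mulr0 addr0.
by exists q; rewrite hornerMXaddC mulr0 add0r addrC commr_polyX.
Qed.

Section DeformedHankel.
Variables (F : fieldType) (n : nat) (z : 'I_n -> F).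
Hypothesis z_inj : injective z.
Local Notation S := {mpoly F[n]}.
Local Notation y := (evalpt z).

(** Products of the values [u(z_i)] with exponents bounded by [c]. *)
Definition eval_box (c : 'I_n -> nat) (p : S) : Prop :=
  exists2 m : 'I_n -> nat, (forall i, m i <= c i)%N & p = \prod_i y i ^+ m i.

Lemma eval_boxM c c' p q : lspan (eval_box c) p -> lspan (eval_box c') q ->
  lspan (eval_box (fun i => c i + c' i)%N) (p * q).
Proof.
apply: lspanM => _ _ [m mc ->] [m' mc' ->]; apply: lspan_gen.
exists (fun i => m i + m' i)%N; first by move=> i; apply: leq_add.
by rewrite -big_split; apply: eq_bigr => i _; rewrite exprD.
Qed.

Lemma theta_evalpt i : theta (y i) = \sum_(k < n) ((z i ^+ k) *: 'X_k : S)%:P * 'X^k.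
Proof.
rewrite [LHS]raddf_sum; apply: eq_bigr => k _ /=.
by rewrite thetaZ thetaX -mul_mpolyC polyCM mulrA.
Qed.

Variable N : nat.
Hypothesis N_le : (N <= n)%N.
Hypothesis N_gt0 : (0 < N)%N.

(** These are the indices [i] with [n - N <= i], where an element [N] of the multiset contributes
    one to the bound on the exponent of u(z_i). *)
Let last_pts (i : 'I_N) : 'I_n := cast_ord (subnK N_le) (rshift (n - N) i).

Let last_pts_inj : injective last_pts.
Proof. by move=> i j /cast_ord_inj/rshift_inj. Qed.

Variable kap : 'I_N -> F.
Hypothesis kapP : forall d : 'I_N,
  \sum_i kap i * z (last_pts i) ^+ d = (d.+1 == N)%:R.

(** A Hankel matrix of rank [N] of the form [V^T D V], with [V] of Vandermonde
    type and [D] diagonal, whose lowest terms form the matrix [hankel]. *)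
Definition deformed_hankel c : S :=
  \sum_i (kap i * z (last_pts i) ^+ c) *: y (last_pts i).

Lemma deformed_hankel_initial c : exists R,
  'X^c * theta (deformed_hankel c) = 'X^(N.-1) * ((hankel F n 0 N c)%:P + 'X * R).
Proof.
pose G (q : {poly S}) (x : S) := exists R, q = 'X^(N.-1) * (x%:P + 'X * R).
have GD q q' x x' : G q x -> G q' x' -> G (q + q') (x + x').
  by move=> [R ->] [R' ->]; exists (R + R'); rewrite polyCD; ring.
have G0 : G 0 0 by exists 0; rewrite polyC0 mulr0 addr0 mulr0.
pose eta d := \sum_i kap i * z (last_pts i) ^+ d.
have -> : 'X^c * theta (deformed_hankel c) =
    \sum_(k < n) (eta (c + k)%N *: 'X_k : S)%:P * 'X^(c + k).
  rewrite /deformed_hankel raddf_sum mulr_sumr.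
  under eq_bigr => i _ do rewrite /= thetaZ theta_evalpt mulr_sumr mulr_sumr.
  rewrite exchange_big; apply: eq_bigr => k _ /=.
  rewrite /eta scaler_suml raddf_sum mulr_suml; apply: eq_bigr => i _ /=.
  have -> : ((kap i * z (last_pts i) ^+ (c + k)) *: 'X_k : S)%:P =
      ((kap i * z (last_pts i) ^+ c)%:MP)%:P * (z (last_pts i) ^+ k *: 'X_k : S)%:P.
    by rewrite -polyCM mul_mpolyC scalerA exprD mulrA.
  by rewrite [X in _ = _ * X]exprD -[RHS]mulrA mulrCA; congr (_ * _); rewrite mulrCA.
have -> : hankel F n 0 N c = \sum_(k < n) (if (c + k).+1 == N then 'X_k else 0).
  rewrite /hankel add0n; case: ltnP => cN; last first.
    by rewrite big1 // => k _; rewrite ifN //; apply/eqP; lia.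
  have kn : (N - c.+1 < n)%N by lia.
  rewrite (bigD1 (Ordinal kn)) //= big1 => [|k kk]; last first.
    rewrite ifN //; apply: contra kk => /eqP kN; apply/eqP/val_inj => /=; lia.
  by rewrite addr0 ifT -?xvarE //; apply/eqP; lia.
rewrite -/(G _ _); apply: (big_ind2 G); [exact: G0|by move=> *; apply: GD|move=> k _].
have [ckN|ckN] := ltnP (c + k) N.
  have eE := kapP (Ordinal ckN); rewrite /= in eE.
  rewrite /eta eE; case: eqP => [ckE|_]; last by rewrite scale0r polyC0 mul0r.
  exists 0; rewrite scale1r mulr0 addr0 mulrC; congr ('X^_ * _); lia.
exists ((eta (c + k)%N *: 'X_k : S)%:P * 'X^(c + k - N)).
rewrite ifN; last by apply/eqP; lia.
rewrite polyC0 add0r [X in _ = _ * X]mulrCA [RHS]mulrCA; congr (_ * _).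
by rewrite -exprS -exprD; congr ('X^_); lia.
Qed.

(** Multiplying row [i] by ['X^(al i)] and column [j] by ['X^(be j)] makes every entry divisible by
    ['X^(N.-1)], and the constant terms of the quotients are the entries of [hankel]. *)
Lemma deformed_minor_initial r (al be : 'I_r -> nat) :
  initial_form (\det (\matrix_(i, j) deformed_hankel (al i + be j)))
    (\det (\matrix_(i, j) hankel F n 0 N (al i + be j))).
Proof.
have /choice[R RE] c := deformed_hankel_initial c.
pose B : 'M[{poly S}]_r := \matrix_(i, j)
  ((hankel F n 0 N (al i + be j))%:P + 'X * R (al i + be j)%N).
have [R' R'E] := poly_const_mulX (\det B).
exists (\sum_i al i + \sum_j be j)%N, (N.-1 * r)%N, R'.
have B0 : (\det B).[0] = \det (\matrix_(i, j) hankel F n 0 N (al i + be j)).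
  rewrite -[LHS]/(horner_eval 0 (\det B)) -det_map_mx; congr (\det _).
  apply/matrixP => i j; rewrite /B !mxE /= /horner_eval hornerD hornerC hornerM hornerX.
  by rewrite mul0r addr0.
rewrite -B0 -R'E exprM -detZ exprD -!prodrXr -det_map_mx -det_scale_rows_cols.
congr (\det _); apply/matrixP => i j; rewrite !mxE -exprD.
exact: RE.
Qed.

(** Cauchy-Binet: expand over the choice [f] of a point for each row. A repeated point yields two
    equal rows, so only products of distinct u(z_i) remain. *)
Lemma deformed_minor_box r (al be : 'I_r -> nat) :
  lspan (eval_box (fun i => (n - N <= i)%N : nat))
    (\det (\matrix_(i, j) deformed_hankel (al i + be j))).
Proof.
have -> : \det (\matrix_(i, j) deformed_hankel (al i + be j)) =
    \sum_(f : {ffun 'I_r -> 'I_N}) (\prod_i (kap (f i) * z (last_pts (f i)) ^+ al i) *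
      \det (\matrix_(i, j) z (last_pts (f i)) ^+ be j)) *: \prod_i y (last_pts (f i)).
  rewrite /determinant.
  under [RHS]eq_bigr => f _ do rewrite mulr_sumr scaler_suml.
  rewrite [RHS]exchange_big; apply: eq_bigr => s _ /=.
  under eq_bigr => i _ do rewrite mxE /deformed_hankel.
  rewrite bigA_distr_bigA mulr_sumr; apply: eq_bigr => f _ /=.
  rewrite scaler_prod -(rmorph_sign (@mpolyC n F)) mul_mpolyC scalerA; congr (_ *: _).
  rewrite mulrCA; congr (_ * _); rewrite -big_split; apply: eq_bigr => i _ /=.
  by rewrite mxE exprD mulrA.
apply: lspan_sum => f _; have [f_inj|/injectivePn[i [j ij fij]]] := boolP (injectiveb f).
  apply: lspanZ; apply: lspan_gen.
  exists (fun k => (k \in [set last_pts (f i) | i : 'I_r]) : nat).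
    move=> k; case: imsetP => // -[i _ ->] /=; rewrite leq_addr //.
  rewrite [RHS](bigID (mem [set last_pts (f i) | i : 'I_r])) /=.
  rewrite [X in _ = _ * X]big1 => [|k /negPf->//]; rewrite mulr1.
  under [RHS]eq_bigr => k -> do rewrite expr1.
  by rewrite big_imset //= => i j _ _ /last_pts_inj/(injectiveP _ f_inj).
rewrite (determinant_alternate ij) ?mulr0 ?scale0r; first by constructor.
by move=> k; rewrite !mxE fij.
Qed.

End DeformedHankel.

Section HankelInitial.
Variables (F : fieldType) (n : nat) (z : 'I_n -> F).
Hypothesis z_inj : injective z.

Lemma hankel_minor_initial N x : (0 < N <= n)%N -> hankel_minor (F := F) (n := n) 0 N x ->
  exists P, lspan (eval_box z (fun i => (n - N <= i)%N : nat)) P /\ initial_form P x.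
Proof.
move=> /andP[N0 Nn] [r [al [be ->]]].
have [|kap kapP] := @dual_interpolation F N
  (fun i => z (cast_ord (subnK Nn) (rshift (n - N) i))) (fun d => (d.+1 == N)%:R).
  by move=> i j /z_inj/cast_ord_inj/rshift_inj.
exists (\det (\matrix_(i, j) deformed_hankel z Nn kap (al i + be j))); split.
  exact: deformed_minor_box.
exact: deformed_minor_initial.
Qed.

Lemma hankel_prod_initial Ns x : all (fun N => 0 < N <= n)%N Ns ->
  hankel_prod (F := F) (n := n) 0 Ns x ->
  exists P, lspan (eval_box z (fun i => count (fun N => n - N <= i)%N Ns)) P /\ initial_form P x.
Proof.
elim: Ns x => [|N Ns IH] x /=.
  move=> _ ->; exists 1; split; last exact: initial_form1.
  by apply: lspan_gen; exists (fun=> 0%N) => //; rewrite big1.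
move=> /andP[N0 Ns0] [y [y' [/(hankel_minor_initial N0)[P [Pbox Py]]]]].
move=> /(IH _ Ns0)[Q [Qbox Qy']] ->; exists (P * Q); split.
  exact: eval_boxM.
exact: initial_formM.
Qed.

End HankelInitial.

(** * The span of the coordinates as the span of the products of minors *)

Section HankelSpan.
Variables (F : fieldType).

Lemma lspan_family (V : lmodType F) D (w : 'I_D -> V) x :
  lspan (fun x => exists j, x = w j) x -> exists c, x = \sum_j c j *: w j.
Proof.
elim=> [|b _ y [j ->] _ [c ->]].
  by exists (fun=> 0); rewrite big1 // => j _; rewrite scale0r.
exists (fun i => (i == j)%:R * b + c i).
under [RHS]eq_bigr do rewrite scalerDl; rewrite big_split; congr (_ + _).
rewrite (bigD1 j) //= eqxx mul1r big1 ?addr0 // => i /negPf->.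
by rewrite mul0r scale0r.
Qed.

(** The coefficients of the independent family in terms of [w] form a matrix with independent rows;
    with at most [d] columns it also has full column rank, and a left inverse expresses the
    [w j]. *)
Lemma indep_spanning (V : lmodType F) d D (w : 'I_D -> V) (S : V -> Prop) :
  indep_in d (lspan S) -> (forall x, S x -> lspan (fun x => exists j, x = w j) x) ->
  (D <= d)%N -> forall j, lspan S (w j).
Proof.
move=> [f [Sf free_f]] Sw Dd j.
have /choice[c cE] i : exists c, f i = \sum_j c j *: w j.
  by apply/lspan_family/(lspan_sub Sw).
pose C := \matrix_(i, j) c i j.
have Cfree : row_free C.
  apply: inj_row_free => r rC; apply/rowP => i; rewrite mxE; apply: (free_f (fun i => r 0 i)).
  under eq_bigr => k _ do rewrite cE scaler_sumr.
  rewrite exchange_big big1 // => l _.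
  under eq_bigr => k _ do rewrite scalerA.
  have rC0 : \sum_k r 0 k * c k l = 0.
    have := congr1 (fun A : 'rV_D => A 0 l) rC; rewrite /= !mxE => E; rewrite -[RHS]E.
    by apply: eq_bigr => k _; rewrite mxE.
  by rewrite -scaler_suml rC0 scale0r.
have /row_fullP[B BC] : row_full C.
  by move: Cfree (rank_leq_col C); rewrite /row_free /row_full => /eqP->; rewrite eqn_leq Dd => ->.
have -> : w j = \sum_i B j i *: f i.
  under eq_bigr => k _ do rewrite cE scaler_sumr.
  rewrite exchange_big (bigD1 j) //= [X in _ + X]big1 ?addr0 => [|l lj].
    under eq_bigr => k _ do rewrite scalerA; rewrite -scaler_suml.
    have := congr1 (fun A : 'M_D => A j j) BC; rewrite !mxE eqxx => E.
    rewrite (_ : \sum_i _ = 1) ?scale1r // -[RHS]E.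
    by apply: eq_bigr => k _; rewrite mxE.
  under eq_bigr => k _ do rewrite scalerA; rewrite -scaler_suml.
  have := congr1 (fun A : 'M_D => A j l) BC; rewrite !mxE eq_sym (negPf lj) => E.
  rewrite (_ : \sum_i _ = 0) ?scale0r // -[RHS]E.
  by apply: eq_bigr => k _; rewrite mxE.
by apply: lspan_sum => i _; apply: lspanZ.
Qed.

Variable n : nat.
Local Notation S := {mpoly F[n]}.
Local Notation prods Ns := (hankel_prod (F := F) (n := n) 0 Ns).

Lemma hankel_prod_cat Ns Ns' (x : S) :
  prods (Ns ++ Ns') x <-> exists y y', [/\ prods Ns y, prods Ns' y' & x = y * y'].
Proof.
elim: Ns x => [|N Ns IH] x /=.
  split=> [px|[_ [y' [-> py' ->]]]]; last by rewrite mul1r.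
  by exists 1, x; rewrite mul1r.
split=> [[p [q [pN /IH[y [y' [py py' ->]]] ->]]]|[_ [y' [[p [q [pN qN ->]]] py' ->]]]].
  by exists (p * y), y'; split=> //; [exists p, y | rewrite mulrA].
by exists p, (q * y'); split=> //; [apply/IH; exists q, y' | rewrite mulrA].
Qed.

Lemma hankel_prod_perm Ns Ns' (x : S) : perm_eq Ns Ns' -> prods Ns x -> prods Ns' x.
Proof.
apply: (catCA_perm_ind (P := fun Ns => prods Ns x)) => s1 s2 s3.
move=> /hankel_prod_cat[p1 [_ [h1 /hankel_prod_cat[p2 [p3 [h2 h3 ->]]] ->]]].
apply/hankel_prod_cat; exists p2, (p1 * p3); rewrite mulrCA; split=> //.
by apply/hankel_prod_cat; exists p1, p3.
Qed.

Definition spans D (w : 'I_D -> S) (P : S -> Prop) :=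
  (forall x, P x -> lspan (fun x => exists j, x = w j) x) /\ (forall j, lspan P (w j)).

Lemma dominates_hankel (M N : vectType F)
    (w : 'I_(\dim {:M}) -> S) (w' : 'I_(\dim {:N}) -> S) K NsM NsN Ns :
  spans w (prods NsM) -> spans w' (prods NsN) ->
  perm_eq (flatten (nseq K NsM)) (NsN ++ Ns) -> dominates w w' K (prods Ns).
Proof.
move=> [Mw wM] [Nw' w'N] perm_MN.
have forms k x : prods (flatten (nseq k NsM)) x ->
    exists2 p : {mpoly F[\dim {:M}]}, p \is k.-homog & subst w p = x.
  elim: k x => [x ->|k IH x /hankel_prod_cat[y [y' [/Mw/lspan_family[c ->]]]]] /=.
    by exists 1; [apply: dhomog1 | rewrite rmorph1].
  move=> /IH[p homp <-] ->.
  exists ((\sum_j c j *: 'X_j) * p).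
    rewrite -add1n dhomogM //; apply: rpred_sum => j _.
    by apply: dhomogZ; apply: dhomogXU.
  rewrite substM subst_sum; congr (_ * _); apply: eq_bigr => j _.
  by rewrite substZ substX.
split=> [g gN|j].
  suff /choice[p pP] i : exists p : {mpoly F[\dim {:M}]}, p \is K.-homog /\ subst w p = w' i * g.
    by exists p.
  have : lspan (prods (flatten (nseq K NsM))) (w' i * g).
    apply: (lspanM (S := prods NsN) (T := prods Ns)) (w'N i) (lspan_gen gN) => u u' hu hu'.
    apply: lspan_gen; apply: (@hankel_prod_perm (NsN ++ Ns)); first by rewrite perm_sym.
    by apply/hankel_prod_cat; exists u, u'.
  elim=> [|c u u' /forms[p homp <-] _ [p' [homp' <-]]].
    by exists 0; rewrite rmorph0; split=> //; apply: dhomog0.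
  exists (c *: p + p'); rewrite rmorphD /= substZ; split=> //.
  by apply: dhomogD => //; apply: dhomogZ.
have : lspan (prods (flatten (nseq K NsM))) (w j ^+ K).
  elim: K {perm_MN} => [|k IH]; first by rewrite expr0; apply: lspan_gen.
  rewrite exprS; apply: (lspanM _ (wM j) IH) => u u' hu hu'; apply: lspan_gen.
  by apply/hankel_prod_cat; exists u, u'.
apply: lspan_sub => x /(hankel_prod_perm perm_MN)/hankel_prod_cat[b [g [bN gN ->]]].
apply: (lspanM (T := eq g)) (Nw' _ bN) (lspan_gen (erefl g)) => _ _ [i ->] <-.
by apply: lspan_gen; exists i, g.
Qed.

End HankelSpan.

Section FusionSchubert.
Variables (F : fieldType) (n : nat) (a : 'I_n -> nat) (z : 'I_n -> F) (Ns : seq nat).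
Hypothesis F0 : [pchar F] =i pred0.
Hypothesis z_inj : injective z.
Hypothesis n_gt0 : (0 < n)%N.
Hypothesis Ns_sorted : sorted leq Ns.
Hypothesis Ns_le : all (fun N => 0 < N <= n)%N Ns.
Hypothesis Ns_count : forall i : 'I_n, (count (fun N => n - N <= i)%N Ns).+1 = a i.
Local Notation M := (fusion a z).
Local Notation v := (lowest_vector F a).
Local Notation act := (@fusion_act F n a z).
Local Notation gV := (gen n (@eval_act F n a z (sl2e F)) v (nilp_len a)).
Local Notation gM := (gen n (act (sl2e F)) (fusion_vector a z) (nilp_len a)).
Local Notation prods := (hankel_prod (F := F) (n := n) 0 Ns).

Lemma gen_box P : lspan (eval_box z (fun i => count (fun N => n - N <= i)%N Ns)) P ->
  exists2 la, scalar la & gV la = P.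
Proof.
elim=> [|c _ y [m mle ->] _ [la la_lin <-]].
  by exists (fun=> 0); [move=> c u u'; rewrite mulr0 addr0 | apply: gen0].
have [i|mu mu_lin <-] := @gen_monomial F n a z F0 m; first by rewrite -Ns_count ltnS.
exists (fun u => c * mu u + la u); last exact: genP.
by move=> d u u'; rewrite mu_lin la_lin; ring.
Qed.

Lemma fusion_prods x : prods x -> exists2 xi : M -> F, scalar xi & gM xi = x.
Proof.
move=> /(hankel_prod_initial z_inj Ns_le)[P [/gen_box[la la_lin <-] Px]].
exact: fusion_initial Px.
Qed.

Lemma hankel_dim_prod : hankel_dim n Ns = (\prod_i a i)%N.
Proof.
rewrite /hankel_dim (reindex_inj rev_ord_inj); apply: eq_bigr => i _ /=.
rewrite -Ns_count; congr _.+1; apply: eq_in_count => N /(allP Ns_le) /= N_le.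
by have := ltn_ord i; lia.
Qed.

Lemma fusion_spans : spans (fun j => gM (@xcoord F M j)) prods.
Proof.
have Mw x : prods x -> lspan (fun x => exists j, x = gM (@xcoord F M j)) x.
  move=> /fusion_prods[xi xi_lin <-]; rewrite gen_coords //.
  by apply: lspan_sum => j _; apply: lspanZ; apply: lspan_gen; exists j.
split=> // j; have le_dim : (\dim {:M} <= hankel_dim n Ns)%N.
  by rewrite hankel_dim_prod dim_fusion.
apply: (indep_spanning _ Mw le_dim); apply: hankel_prod_indep => //.
by apply: sub_all Ns_le => N /andP[].
Qed.

Lemma schubertP L : schubert a z L <-> in_closure (fun j => gM (@xcoord F M j)) L.
Proof.
(* Empty minors put 1 among the products, so some functional is constantly 1 on the parametrization,
   which therefore never vanishes. *)
have one : prods 1.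
  by elim: Ns => //= N Ns' IH; exists 1, 1; rewrite mulr1; split=> //; apply: hankel_minor1.
have [xi0 xi0_lin gen_xi0] := fusion_prods one.
have [tre trf trh] := sl2_trace F.
rewrite /schubert.
apply: (@closure_orbitP F n M F0 (act (sl2e F)) (act (sl2f F)) (act (sl2h F)) _
  (fun k => if k == 0%N then lowest_weight a z 0 else 0) (nilp_len a)) xi0_lin gen_xi0 _ n_gt0 L => //.
- exact: act_linear.
- exact: act_linear.
- exact: act_linear.
- exact: act_ee.
- exact: act_he.
- exact: act_fe.
- exact: act_f_vector.
- exact: act_h_vector.
- by move=> k u nk; apply: act_e_trunc.
- by move=> t u; apply: word_nilp => // t' u' ?; apply: ev_e_nilp.
- by move=> t u; apply: word_nilp => // t' u' ?; apply: ev_f_nilp.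
Qed.

Lemma fusion_proj : exists L : proj M, True.
Proof.
have /line_proj[L _] : fusion_vector a z != 0; last by exists L.
apply/eqP => /(congr1 (gc 0)); rewrite gc_vector gc0 /= => /ffunP.
have apos i : (0 < a i)%N by rewrite -Ns_count.
move=> /(_ [ffun i => Ordinal (apos i)]); rewrite !ffunE.
rewrite (_ : [forall i, _]) => [/eqP|]; first by rewrite oner_eq0.
by apply/forallP => i; rewrite ffunE.
Qed.

End FusionSchubert.

(** * Types of tuples and multiplicities in the multisets *)

Section Jumps.
Local Open Scope nat_scope.

(** The multiset containing [n - k] with multiplicity [m k], for [k < n]. *)
Definition jump_seq n (m : nat -> nat) : seq nat :=
  sort leq (flatten [seq nseq (m k) (n - k) | k <- iota 0 n]).

Lemma jump_seq_sorted n m : sorted leq (jump_seq n m).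
Proof. exact/sort_sorted/leq_total. Qed.

Lemma count_jump_seq n m (p : pred nat) :
  count p (jump_seq n m) = \sum_(k < n) m k * p (n - k).
Proof.
rewrite /jump_seq count_sort count_flatten sumnE !big_map -(big_mkord xpredT (fun k => m k * p (n - k))).
rewrite /index_iota subn0; apply: eq_bigr => k _.
by rewrite count_nseq mulnC.
Qed.

Lemma jump_seq_le n m : all (fun N => 0 < N <= n) (jump_seq n m).
Proof.
rewrite all_sort; apply/allP => N /flattenP[s /mapP[k]]; rewrite mem_iota => kn -> /nseqP[-> _].
lia.
Qed.

Lemma jump_seq_perm n K (m m' : nat -> nat) : (forall k, k < n -> m' k <= K * m k) ->
  perm_eq (flatten (nseq K (jump_seq n m)))
          (jump_seq n m' ++ jump_seq n (fun k => K * m k - m' k)).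
Proof.
move=> mK; apply/seq.permP => p; rewrite count_cat !count_jump_seq count_flatten map_nseq sumn_nseq.
rewrite count_jump_seq mulnC big_distrr -big_split; apply: eq_bigr => k _ /=.
by rewrite -mulnDl subnKC ?mK // mulnA.
Qed.

(** With 1 as the value before the first entry, the partial sums are the entries minus one, that is,
    the largest exponents of the u(z_i). *)
Definition jump (A : seq nat) k : nat := nth 0 A k - (if k is k'.+1 then nth 0 A k' else 1).

Lemma sum_jump (A : seq nat) i : sorted leq A -> all (leq 1) A -> i < size A ->
  (\sum_(k < i.+1) jump A k).+1 = nth 0 A i.
Proof.
move=> sA A1; elim: i => [|i IH] iA.
  by rewrite big_ord1 /jump subn1 prednK //; apply: (all_nthP 0 A1).
rewrite big_ord_recr /= -addSn IH ?(ltnW iA) // /jump subnKC //.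
by apply: (sorted_leq_nth leq_trans leqnn) sA _ _ _ _ _ => //; rewrite inE // ltnW.
Qed.

Lemma count_jump (A : seq nat) i : sorted leq A -> all (leq 1) A -> i < size A ->
  (count (fun N => size A - N <= i) (jump_seq (size A) (jump A))).+1 = nth 0 A i.
Proof.
move=> sA A1 iA; rewrite -sum_jump // count_jump_seq; congr _.+1.
rewrite -(big_mkord xpredT (jump A)).
rewrite -(big_mkord xpredT (fun k => jump A k * (size A - (size A - k) <= i))).
rewrite (big_cat_nat (leq0n i.+1) iA) /= [X in _ + X]big_nat_cond [X in _ + X]big1 ?addn0.
  rewrite big_nat_cond [RHS]big_nat_cond; apply: eq_bigr => k /andP[/andP[_ ki] _].
  have -> : size A - (size A - k) <= i = true by lia.
  by rewrite muln1.
move=> k /andP[/andP[ik kA] _].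
have -> : size A - (size A - k) <= i = false by lia.
by rewrite muln0.
Qed.

Lemma type_nth_eq (A B s : seq nat) : of_type A s -> of_type B s ->
  size A = size B /\
  forall k, k.+1 < size A -> (nth 0 A k == nth 0 A k.+1) = (nth 0 B k == nth 0 B k.+1).
Proof.
move=> [s1 [c [cs c_sorted ->]]] [_ [d [ds d_sorted ->]]].
elim: s c d s1 cs ds c_sorted d_sorted => [|i s IH] [|x c] [|y d] //=.
move=> /andP[i1 s1] [cs] [ds] cx dy.
have [sz nthE] := IH c d s1 cs ds (path_sorted cx) (path_sorted dy).
rewrite !size_cat !size_nseq sz; split=> // k kA.
rewrite !nth_cat !size_nseq !nth_nseq.
have [ki|ik] := ltnP k.+1 i; first by rewrite ltnW // !eqxx.
have [ki|ik'] := ltnP k i; last first.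
  by have := nthE (k - i); rewrite subSn //; apply; lia.
(* Here [k] is the last index of the first block. The next block is nonempty and has another value,
   in both tuples. *)
have -> : k.+1 - i = 0 by lia.
case: s c d s1 cs ds cx dy {IH nthE} sz kA => [|j s] [|x' c] [|y' d] //=.
  by move=> _ _ _ _ _ _; lia.
move=> /andP[j1 _] _ _ /andP[xx' _] /andP[yy' _] _ _.
by case: j j1 => //= j _; rewrite (negPf xx') (negPf yy').
Qed.

(** Beyond index 0 a positive jump means that neighbours differ, which the type determines; at index
    0 the jump is positive because the entries are at least 2. *)
Lemma type_jump_gt0 (A B s : seq nat) : of_type A s -> of_type B s ->
  sorted leq A -> all (leq 2) A -> all (leq 2) B ->
  forall k, k < size A -> 0 < jump B k -> 0 < jump A k.
Proof.
move=> As Bs sA A2 B2 [|k] kA; first by rewrite /jump !subn_gt0; move=> _; apply: (all_nthP 0 A2).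
have [sz eqAB] := type_nth_eq As Bs; rewrite /jump !subn_gt0 => Bk.
have := eqAB k kA; rewrite (ltn_eqF Bk) => Ak.
rewrite ltn_neqAle Ak.
by apply: (sorted_leq_nth leq_trans leqnn) sA _ _ _ _ _ => //; rewrite inE // ltnW.
Qed.

End Jumps.

Lemma dominates_fusion (F : fieldType) n (M N : vectType F)
    (w : 'I_(\dim {:M}) -> {mpoly F[n]}) (w' : 'I_(\dim {:N}) -> {mpoly F[n]}) m m' :
  (forall k, (k < n)%N -> (0 < m' k)%N -> (0 < m k)%N) ->
  spans w (hankel_prod 0 (jump_seq n m)) -> spans w' (hankel_prod 0 (jump_seq n m')) ->
  exists K G, dominates w w' K G.
Proof.
(* What matters is [m' k <= K * m k] for every [k]: the sum bounds each [m' k], and [m k] is at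
   least 1 wherever [m' k] is positive. *)
move=> mm' sw sw'; pose K := (\sum_(k < n) m' k)%N.
exists K, (hankel_prod 0 (jump_seq n (fun k => K * m k - m' k)%N)).
apply: (dominates_hankel sw sw'); apply: jump_seq_perm => k kn.
case: (posnP (m' k)) => [->//|mk]; have m0 := mm' k kn mk.
apply: leq_trans (leq_pmulr _ m0).
by rewrite /K (bigD1 (Ordinal kn)) //= leq_addr.
Qed.

Theorem theorem2p1 (R : realType) (n : nat) (n_ge1 : (1 <= n)%N)
    (A B : n.-tuple nat) (s : seq nat)
    (A_sorted : sorted leq A) (B_sorted : sorted leq B)
    (A_ge2 : all (leq 2) A) (B_ge2 : all (leq 2) B)
    (A_type : of_type A s) (B_type : of_type B s)
    (zA zB : 'I_n -> complex R)
    (zA_inj : injective zA) (zB_inj : injective zB) :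
  proj_isomorphic (schubert (tnth A) zA) (schubert (tnth B) zB).
Proof.
have C0 : [pchar complex R] =i pred0 by exact: Num.Theory.pchar_num.
have cnt (X : n.-tuple nat) : sorted leq X -> all (leq 2) X -> forall i : 'I_n,
    (count (fun N => n - N <= i)%N (jump_seq n (jump X))).+1 = tnth X i.
  move=> sX X2 i; have X1 : all (leq 1) X by apply: sub_all X2 => k; apply: ltnW.
  by have := @count_jump X i sX X1; rewrite size_tuple (tnth_nth 0%N) => ->.
have cntA := cnt A A_sorted A_ge2; have cntB := cnt B B_sorted B_ge2.
have srt X := jump_seq_sorted n (jump X); have lex X := jump_seq_le n (jump X).
have spA := fusion_spans C0 zA_inj n_ge1 (srt A) (lex A) cntA.
have spB := fusion_spans C0 zB_inj n_ge1 (srt B) (lex B) cntB.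
have clA := schubertP C0 zA_inj n_ge1 (lex A) cntA.
have clB := schubertP C0 zB_inj n_ge1 (lex B) cntB.
have jAB k : (k < n)%N -> (0 < jump B k)%N -> (0 < jump A k)%N.
  by rewrite -{1}(size_tuple A); apply: (type_jump_gt0 A_type B_type).
have jBA k : (k < n)%N -> (0 < jump A k)%N -> (0 < jump B k)%N.
  by rewrite -{1}(size_tuple B); apply: (type_jump_gt0 B_type A_type).
have [K [G dom]] := dominates_fusion jAB spA spB.
have [K' [G' dom']] := dominates_fusion jBA spB spA.
have [LA _] := fusion_proj zA cntA; have [LB _] := fusion_proj zB cntB.
exact: (closure_isomorphic LA LB clA clB dom dom').
Qed.
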